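(* Let $G$ be an abelian diffeological group and let $X$ be a diffeological space with a generating family $\mathcal{Q}$ whose plots have contractible domains. Then $\check{H}^1(X,G)$ is in bijection with the set of smooth actions of the diffeological groupoid $R(\mathrm{ev}\colon\mathcal{N}(\mathcal{Q})\to X)$ on $\mathcal{N}(\mathcal{Q})\times G$, with anchor map the projection $\mathcal{N}(\mathcal{Q})\times G\to\mathcal{N}(\mathcal{Q})$, that commute with right multiplication by $G$, up to $(R(\mathrm{ev})\text{-}G)$-equivariance.
   Context: A diffeological space is a set $X$ with a set $\mathcal{D}_X$ of maps $p\colon U_p\to X$ (plots), $U_p$ Euclidean open (any dimension), containing all constant maps, closed under precomposition with smooth maps between Euclidean open sets, and such that a map that is locally a plot is a plot. A map is smooth if it sends plots to plots by composition. Products, disjoint sums and fiber products carry the standard diffeologies. A diffeological group is a group with a diffeology making multiplication and inversion smooth. A generating family of $X$ is a family $\mathcal{Q}\subseteq\mathcal{D}_X$ such that every plot $p$ restricts on the members $U_\alpha$ of some open cover of $U_p$ to $q_\alpha\circ f_\alpha$ with $q_\alpha\in\mathcal{Q}$ and $f_\alpha\colon U_\alpha\to U_{q_\alpha}$ smooth. Nebula: $\mathcal{N}(\mathcal{Q})=\coprod_{q\in\mathcal{Q}}U_q$, with $\mathrm{ev}\colon\mathcal{N}(\mathcal{Q})\to X$, $u\in U_q\mapsto q(u)$. $\mathcal{N}(\mathcal{Q})_k$ is the $(k+1)$-fold fiber product of $\mathcal{N}(\mathcal{Q})$ over $X$ along $\mathrm{ev}$; $d_i$ drops the $i$-th entry.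 $\check{H}^k(\mathcal{Q},G)$ is the cohomology of $\check{C}^k(\mathcal{Q},G)=C^\infty(\mathcal{N}(\mathcal{Q})_k,G)$ with $\partial f=\sum_{i=0}^{k+1}(-1)^if\circ d_i$. A refinement of $\mathcal{Q}=\{q_\alpha\}_{\alpha\in A}$ is a generating family $\mathcal{R}=\{r_\beta\}_{\beta\in B}$ with a map $\varphi\colon B\to A$ and smooth maps $f_\beta\colon U_{r_\beta}\to U_{q_{\varphi(\beta)}}$ with $q_{\varphi(\beta)}\circ f_\beta=r_\beta$; pullback along $\coprod f_\beta$ induces $\check{H}^k(\mathcal{Q},G)\to\check{H}^k(\mathcal{R},G)$. $\check{H}^k(X,G)$ is the directed colimit of the $\check{H}^k(\mathcal{Q},G)$ over all generating families ordered by refinement. A diffeological groupoid is a groupoid whose object and arrow sets are diffeological spaces with smooth structure maps. For a smooth map $\pi\colon Y\to X$, $R(\pi)=(Y\times_XY\rightrightarrows Y)$ has source $s(y_1,y_2)=y_2$, target $t(y_1,y_2)=y_1$, multiplication $(y_1,y_2)(y_2,y_3)=(y_1,y_3)$, inversion $(y_1,y_2)\mapsto(y_2,y_1)$, unit $y\mapsto(y,y)$. A smooth (left) action of a diffeological groupoid $H=(H_1\rightrightarrows H_0)$ on a diffeological space $Z$ with smooth anchor $\rho\colon Z\to H_0$ is a smooth map $(h,z)\mapsto h\cdot z$, defined for $s(h)=\rho(z)$, with $\rho(h\cdot z)=t(h)$, $g\cdot(h\cdot z)=(gh)\cdot z$ when $s(g)=t(h)$ and $s(h)=\rho(z)$,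 and units acting trivially. An $H$-equivariant map is a smooth map commuting with anchors and actions. $G$ acts on the right of $\mathcal{N}(\mathcal{Q})\times G$ by $(y,g)\cdot h=(y,g+h)$. Two actions of $R(\mathrm{ev})$ are identified ''up to $(R(\mathrm{ev})\text{-}G)$-equivariance'' if there is a smooth map $\mathcal{N}(\mathcal{Q})\times G\to\mathcal{N}(\mathcal{Q})\times G$ that is equivariant for the right $G$-action and for $R(\mathrm{ev})$ acting by the first action on the domain and by the second action on the codomain. *)

(* Defs.v *)
From Stdlib Require Import Relation_Operators.
From HB Require Import structures.
From mathcomp Require Import all_boot all_order all_algebra.
From mathcomp Require Import all_classical all_reals.
From mathcomp Require Import topology normedtype landau derive.

Set Implicit Arguments.
Unset Strict Implicit.
Unset Printing Implicit Defensive.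

Import Order.TTheory GRing.Theory Num.Theory.
Import numFieldNormedType.Exports.

Local Open Scope classical_set_scope.
Local Open Scope ring_scope.

(* C^k on U by iterated Frechet differentiation; meant for open U and V of    *)
(* finite dimension, where x |-> 'd f x is C^k iff all the x |-> 'D_v f x are *)
Fixpoint Ck (R : realType) (V W : normedModType R) (k : nat) (U : set V)
    (f : V -> W) : Prop :=
  if k is k'.+1
  then (forall x, U x -> differentiable f x) /\
       (forall v : V, Ck k' U ('D_v f))
  else forall x, U x -> {for x, continuous f}.

Lemma near_eq_differentiable (R : realType) (V W : normedModType R)
    (f g : V -> W) (x : V) :
  (\near x, f x = g x) -> differentiable f x -> differentiable g x.
Proof.
move=> fg dfx; have [dfc /eqaddoP fo] := (diff_locallyP _ _).1 dfx.
have go : g \o shift x = cst (g x) + 'd f x +o_ 0 id.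
  apply/eqaddoP => e e0; have := fo e e0.
  have nfg : \forall h \near (0 : V), f (h + x) = g (h + x).
    by move: fg; rewrite {1}(near_shift 0 x) subr0.
  apply: filterS2 nfg => h fgh; rewrite -(nbhs_singleton fg).
  by rewrite /= [(f \o _ - _) h]/(f (h + x) - _) [(g \o _ - _) h]/(g (h + x) - _) fgh.
by apply/diff_locallyP; rewrite (diff_unique dfc go).
Qed.

Section Ck_theory.
Context {R : realType}.
Implicit Types V W : normedModType R.

Lemma Ck_eq V W k (U : set V) (f g : V -> W) : open U ->
  (forall x, U x -> f x = g x) -> Ck k U f -> Ck k U g.
Proof.
move=> oU; elim: k f g => [|k IH] f g fg /=.
  move=> cf x Ux; have := cf x Ux; rewrite /prop_for /continuous_at -(fg x Ux) => fx.
  apply: cvg_trans fx; apply: near_eq_cvg.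
  by apply: filterS (open_nbhs_nbhs (conj oU Ux)) => y /fg.
case=> df Cf; split=> [x Ux|v].
  apply: near_eq_differentiable (df x Ux).
  by apply: filterS (open_nbhs_nbhs (conj oU Ux)) => y /fg.
apply: IH (Cf v) => x Ux; apply: near_eq_derive.
by apply: filterS (open_nbhs_nbhs (conj oU Ux)) => y /fg.
Qed.

Lemma Ck_sub V W k (A B : set V) (f : V -> W) : A `<=` B -> Ck k B f -> Ck k A f.
Proof.
move=> AB; elim: k f => [|k IH] f /=; first by move=> cf x /AB/cf.
by case=> df Cf; split=> [x /AB/df//|v]; exact: IH.
Qed.

Lemma Ck_local V W k (U : set V) (f : V -> W) :
  (forall x, U x -> exists2 A : set V, A x & Ck k A f) -> Ck k U f.
Proof.
elim: k f => [|k IH] f /= loc; first by move=> x /loc[A Ax]; exact.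
split=> [x /loc[A Ax [df _]]|v]; first exact: df.
by apply: IH => x /loc[A Ax [_ Cf]]; exists A.
Qed.

Lemma Ck_cst V W k (U : set V) (w : W) : Ck k U (cst w).
Proof.
elim: k w => [|k IH] w /=; first by move=> x _; exact: cst_continuous.
split=> [x _|v]; first exact: differentiable_cst.
have -> : 'D_v (cst w : V -> W) = cst 0 by apply/funext => x; exact: derive_cst.
exact: IH.
Qed.

Lemma CkW V W k (U : set V) (f : V -> W) : Ck k.+1 U f -> Ck k U f.
Proof.
elim: k f => [|k IH] f.
  by case=> df _ x Ux; exact/differentiable_continuous/df.
by case=> df Cf; split=> // v; exact/IH/Cf.
Qed.

Lemma CkD V W k (U : set V) (f g : V -> W) : open U ->
  Ck k U f -> Ck k U g -> Ck k U (f + g).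
Proof.
move=> oU; elim: k f g => [|k IH] f g.
  by move=> cf cg x Ux; apply: continuousD; [exact: cf|exact: cg].
move=> [df Cf] [dg Cg]; split=> [x Ux|v].
  by apply: differentiableD; [exact: df|exact: dg].
apply: Ck_eq (IH _ _ (Cf v) (Cg v)) => // x Ux.
by rewrite [LHS]/('D_v f x + 'D_v g x) deriveD//; by apply: diff_derivable; (exact: df || exact: dg).
Qed.

Lemma Ck_sum V W k n (U : set V) (f : 'I_n -> V -> W) : open U ->
  (forall i, Ck k U (f i)) -> Ck k U (\sum_(i < n) f i).
Proof.
move=> oU Cf; elim/big_ind : _ => //; last by move=> *; exact: CkD.
exact: (@Ck_cst V W k U 0).
Qed.

Lemma CkM V k (U : set V) (f g : V -> R) : open U ->
  Ck k U f -> Ck k U g -> Ck k U (f * g).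
Proof.
move=> oU; elim: k f g => [|k IH] f g.
  by move=> cf cg x Ux; apply: continuousM; [exact: cf|exact: cg].
move=> Cf Cg; have [Cf' Cg'] := (CkW Cf, CkW Cg).
case: Cf Cg => [df Cf] [dg Cg]; split=> [x Ux|v].
  by apply: differentiableM; [exact: df|exact: dg].
apply: Ck_eq (CkD oU (IH _ _ Cf' (Cg v)) (IH _ _ Cg' (Cf v))) => // x Ux.
by rewrite deriveM//; by apply: diff_derivable; (exact: df || exact: dg).
Qed.

Lemma Ck_linear V W (W' : normedModType R) k (U : set V) (f : V -> W)
    (l : {linear W -> W'}) : continuous l -> open U ->
  Ck k U f -> Ck k U (l \o f).
Proof.
move=> lc oU; elim: k f => [|k IH] f.
  by move=> cf x Ux; apply: continuous_comp; [exact: cf|exact: lc].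
move=> [df Cf]; split=> [x Ux|v].
  by apply: differentiable_comp; [exact: df|exact: linear_differentiable].
apply: Ck_eq (IH _ (Cf v)) => // x Ux.
have dl y : differentiable l y by exact: linear_differentiable.
rewrite [RHS]deriveE; last by apply: differentiable_comp => //; exact: df.
rewrite diff_comp//; last exact: df.
by rewrite /= diff_lin// deriveE//; exact: df.
Qed.

Lemma Ck_coord V k n (U : set V) (f : V -> 'rV[R]_n) i : open U ->
  Ck k U f -> Ck k U (fun x => f x 0 i).
Proof.
move=> oU Cf.
have @l : {linear 'rV[R]_n -> R}.
  by exists (fun N : 'rV[R]_n => N 0 i); do 2![eexists]; do ?[constructor];
     rewrite ?mxE// => ? *; rewrite ?mxE//; move=> ?; rewrite !mxE.
by apply: (@Ck_linear V _ _ k U f l) => //; exact: coord_continuous.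
Qed.

Lemma Ck_mx V k n (U : set V) (f : V -> 'rV[R]_n) : open U ->
  (forall i, Ck k U (fun x => f x 0 i)) -> Ck k U f.
Proof.
move=> oU Cf.
suff : Ck k U (\sum_(i < n) fun x => f x 0 i *: delta_mx (0 : 'I_1) i).
  by apply: Ck_eq => // x Ux; rewrite fct_sumE -row_sum_delta.
apply: Ck_sum => // i; pose w : 'rV[R]_n := delta_mx 0 i.
have sl : linear ( *:%R ^~ w : R -> _).
  by move=> u y z; rewrite scalerDl scalerA.
pose l : {linear R -> 'rV[R]_n} :=
  HB.pack ( *:%R ^~ w) (GRing.isLinear.Build _ _ _ _ _ sl).
by apply: (@Ck_linear V _ _ k U _ l) => //; exact: scalel_continuous.
Qed.

Lemma Ck_comp1 V k n (U : set V) (B : set 'rV[R]_n) (f : V -> 'rV[R]_n)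
    (g : 'rV[R]_n -> R) : open U -> open B -> (forall x, U x -> B (f x)) ->
  Ck k U f -> Ck k B g -> Ck k U (g \o f).
Proof.
move=> oU oB UB; elim: k f UB g => [|k IH] f UB g.
  by move=> cf cg x Ux; apply: continuous_comp; [exact: cf|apply: cg; exact: UB].
move=> Cf; have Cf' := CkW Cf; case: Cf => df Cf [dg Cg]; split=> [x Ux|v].
  by apply: differentiable_comp; [exact: df|apply: dg; exact: UB].
pose h := \sum_(i < n) (('D_(delta_mx (0 : 'I_1) i) g \o f) *
                       (fun x => 'D_v f x 0 i)).
apply: (@Ck_eq _ _ _ _ h) => // [x Ux|]; last first.
  apply: Ck_sum => // i; apply: CkM => //; last exact: (Ck_coord _ oU (Cf v)).
  exact: (IH _ UB _ Cf' (Cg _)).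
have dgx := dg _ (UB x Ux); have dfx := df x Ux.
rewrite [RHS]deriveE; last exact: differentiable_comp.
rewrite diff_comp//= -(deriveE v dfx) [in RHS](row_sum_delta ('D_v f x)) linear_sum.
rewrite /h fct_sumE; apply: eq_bigr => i _.
by rewrite linearZ/= -(deriveE _ dgx) mulrC.
Qed.

Lemma Ck_comp V k m n (U : set V) (B : set 'rV[R]_n) (f : V -> 'rV[R]_n)
    (g : 'rV[R]_n -> 'rV[R]_m) : open U -> open B ->
  (forall x, U x -> B (f x)) -> Ck k U f -> Ck k B g -> Ck k U (g \o f).
Proof.
move=> oU oB UB Cf Cg; apply: Ck_mx => // i.
by apply: (@Ck_comp1 V k n U B f (fun y => g y 0 i) oU oB UB Cf); exact: Ck_coord.
Qed.

Lemma Ck_id V k (U : set V) : Ck k U (@id V).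
Proof.
case: k => [|k] /=; first by move=> x _; exact: cvg_id.
split=> [x _|v]; first exact: ex_diff.
have -> : 'D_v (@id V) = cst v by apply/funext => x; exact: derive_id.
exact: Ck_cst.
Qed.

End Ck_theory.

Record domain (R : realType) := Domain {
  ddim : nat;
  dset : set 'rV[R]_ddim;
  dopen : open dset }.
Arguments ddim {R} U : rename.
Arguments dset {R} U _ : rename.
Arguments dopen {R} U : rename.

Definition dom_sort (R : realType) (U : domain R) := {x : 'rV[R]_(ddim U) | dset U x}.
Coercion dom_sort : domain >-> Sortclass.

Section Domain.
Context {R : realType}.
Implicit Types U V W : domain R.

Definition dom_smooth U V (f : U -> V) : Prop :=
  exists F : 'rV[R]_(ddim U) -> 'rV[R]_(ddim V),
    (forall k, Ck k (dset U) F) /\ (forall u : U, F (sval u) = sval (f u)).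

Definition subdom U (A : set 'rV[R]_(ddim U)) (oA : open A) : domain R :=
  Domain (openI oA (dopen U)).

Definition subdom_inc U (A : set 'rV[R]_(ddim U)) (oA : open A)
  (x : subdom oA) : U := exist _ (sval x) (proj2 (svalP x)).

(* P holds for the restrictions to the members of some open cover of U *)
Definition locally_on U (P : forall V, (V -> U) -> Prop) : Prop :=
  forall u : U, exists (A : set 'rV[R]_(ddim U)) (oA : open A),
    A (sval u) /\ P (subdom oA) (@subdom_inc U A oA).

(* topological contractibility, for the subspace topology of R^n *)
Definition contractible U : Prop :=
  exists (H : 'rV[R]_(ddim U) * R -> 'rV[R]_(ddim U)) (x0 : 'rV[R]_(ddim U)),
    [/\ {within dset U `*` `[0, 1], continuous H},
        dset U x0,
        forall x t, dset U x -> 0 <= t <= 1 -> dset U (H (x, t)),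
        forall x, dset U x -> H (x, 0) = x &
        forall x, dset U x -> H (x, 1) = x0].

Lemma dom_eq U (x y : U) : sval x = sval y -> x = y.
Proof. by case: x y => x px [y py] /= e; exact: eq_exist. Qed.

Lemma dom_smooth_cst U V (v : V) : dom_smooth (fun _ : U => v).
Proof. by exists (cst (sval v)); split=> // k; exact: Ck_cst. Qed.

Lemma dom_smooth_id U : dom_smooth (@id U).
Proof. by exists id; split=> // k; exact: Ck_id. Qed.

Lemma dom_smooth_comp U V W (g : V -> W) (f : U -> V) :
  dom_smooth f -> dom_smooth g -> dom_smooth (g \o f).
Proof.
move=> [F [CF Ff]] [G [CG Gg]]; exists (G \o F); split=> [k|u]; last first.
  by rewrite /= Ff Gg.
apply: (@Ck_comp R _ k _ _ (dset U) (dset V)) => //; [exact: dopen|exact: dopen|].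
by move=> x Ux; rewrite (Ff (exist _ x Ux)); exact: svalP.
Qed.

Lemma dom_smooth_local U V (f : U -> V) :
  locally_on (fun W i => dom_smooth (f \o i)) -> dom_smooth f.
Proof.
move=> loc.
pose F (x : 'rV[R]_(ddim U)) : 'rV[R]_(ddim V) :=
  if pselect (dset U x) is left Ux then sval (f (exist _ x Ux)) else 0.
have FE (u : U) : F (sval u) = sval (f u).
  rewrite /F; case: pselect => [Ux|/(_ (svalP u))//].
  by congr (sval (f _)); exact: dom_eq.
exists F; split=> // k; apply: Ck_local => x Ux.
have [A [oA [Ax [G [CG Gf]]]]] := loc (exist _ x Ux).
exists (dset (subdom oA)); first by split.
apply: Ck_eq (CG k); first exact: dopen.
by move=> y Ay; rewrite (Gf (exist _ y Ay)) /= -FE.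
Qed.

Lemma locally_on_pull U V (f : V -> U) (P : forall W, (W -> U) -> Prop)
    (P' : forall W, (W -> V) -> Prop) : dom_smooth f ->
  (forall W W' (i : W -> U) (j : W' -> V) (g : W' -> W),
    dom_smooth g -> f \o j = i \o g -> P W i -> P' W' j) ->
  locally_on P -> locally_on P'.
Proof.
move=> [F [CF Ff]] PP' loc v.
have [A [oA [Av PA]]] := loc (f v).
have oB : open (dset V `&` F @^-1` A).
  rewrite openE => x [Vx Ax]; apply: filterI.
    exact: open_nbhs_nbhs (conj (dopen V) Vx).
  by apply: (CF 0%N x Vx); exact: open_nbhs_nbhs (conj oA Ax).
exists _, oB; split; first by split; [exact: svalP|rewrite /= Ff].

have Bin (x : subdom oB) : dset (subdom oA) (F (sval x)).
  move: (svalP x) => [[Vx Ax] _]; split=> //.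
  by rewrite (Ff (exist _ (sval x) Vx)); exact: svalP.
pose g (x : subdom oB) : subdom oA := exist _ (F (sval x)) (Bin x).
apply: (PP' _ _ _ _ g) PA; last first.
  apply/funext => x; apply: dom_eq; rewrite /= -Ff //.
exists F; split=> // k; apply: Ck_sub (CF k).
by move=> x [[Vx _] _].
Qed.

Lemma locally_on_join U (P : forall W, (W -> U) -> Prop) :
  (forall W W' (i : W -> U) (g : W' -> W), dom_smooth g -> P W i -> P W' (i \o g)) ->
  locally_on (fun W i => locally_on (fun W' i' => P W' (i \o i'))) -> locally_on P.
Proof.
move=> Pcomp loc u; have [A [oA [Au PA]]] := loc u.
have [B [oB [Bu PB]]] := PA (exist _ (sval u) (conj Au (svalP u))).
have oAB : open (A `&` B) by exact: openI.
exists _, oAB; split; first by [].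
have ABin (x : subdom oAB) : dset (@subdom (subdom oA) B oB) (sval x).
  by case: x => x [[Ax Bx] Ux]; split.
pose g (x : subdom oAB) : @subdom (subdom oA) B oB := exist _ (sval x) (ABin x).
have -> : @subdom_inc U _ oAB =
          (@subdom_inc U A oA \o @subdom_inc (subdom oA) B oB) \o g.
  by apply/funext => x; exact: dom_eq.
apply: Pcomp PB; exists id; split=> // k; exact: Ck_id.
Qed.

Lemma locally_onW U (P : forall W, (W -> U) -> Prop) :
  (forall W (i : W -> U), dom_smooth i -> P W i) -> locally_on P.
Proof.
move=> PU u; exists setT, openT; split=> //; apply: PU.
by exists id; split=> // k; exact: Ck_id.
Qed.

End Domain.

HB.mixin Record isDiffeological (R : realType) X := {
  plot : forall U : domain R, (U -> X) -> Prop;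
  plot_cst : forall U (x : X), plot U (fun=> x);
  plot_comp : forall (U V : domain R) (f : V -> U) (p : U -> X),
    dom_smooth f -> plot U p -> plot V (p \o f);
  plot_local : forall (U : domain R) (p : U -> X),
    locally_on (fun V i => plot V (p \o i)) -> plot U p }.

#[short(type="diffType")]
HB.structure Definition Diffeological (R : realType) :=
  {X of isDiffeological R X}.

Arguments plot {R X U} p : rename.

Definition smooth (R : realType) (X Y : diffType R) (f : X -> Y) : Prop :=
  forall (U : domain R) (p : U -> X), plot p -> plot (f \o p).

HB.instance Definition _ (R : realType) (U : domain R) :=
  @isDiffeological.Build R (dom_sort U) (fun V p => dom_smooth p)
    (fun V => @dom_smooth_cst R V U) (fun V W f p => @dom_smooth_comp R W V U p f)
    (fun V p => @dom_smooth_local R V U p).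

Section Constructions.
Context {R : realType}.

Section Prod.
Variables X Y : diffType R.
Definition prod_plot (U : domain R) (p : U -> X * Y) : Prop :=
  plot (fst \o p) /\ plot (snd \o p).

Fact prod_plot_cst (U : domain R) (z : X * Y) : prod_plot (fun _ : U => z).
Proof. by split; exact: plot_cst. Qed.

Fact prod_plot_comp (U V : domain R) (f : V -> U) (p : U -> X * Y) :
  dom_smooth f -> prod_plot p -> prod_plot (p \o f).
Proof. by move=> sf [p1 p2]; split; [exact: plot_comp p1|exact: plot_comp p2]. Qed.

Fact prod_plot_local (U : domain R) (p : U -> X * Y) :
  locally_on (fun V i => prod_plot (p \o i)) -> prod_plot p.
Proof.
by move=> loc; split; apply: plot_local => u; have [A [oA [Au []]]] := loc u;
  exists A, oA.
Qed.

HB.instance Definition _ := isDiffeological.Build R (X * Y)%type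
  prod_plot_cst prod_plot_comp prod_plot_local.
End Prod.

Section Fun.
Variables (I : Type) (X : diffType R).
Definition fun_plot (U : domain R) (p : U -> I -> X) : Prop :=
  forall i, plot (fun u => p u i).

Fact fun_plot_cst (U : domain R) (z : I -> X) : fun_plot (fun _ : U => z).
Proof. by move=> i; exact: plot_cst. Qed.

Fact fun_plot_comp (U V : domain R) (f : V -> U) (p : U -> I -> X) :
  dom_smooth f -> fun_plot p -> fun_plot (p \o f).
Proof. by move=> sf pp i; exact: plot_comp (pp i). Qed.

Fact fun_plot_local (U : domain R) (p : U -> I -> X) :
  locally_on (fun V i => fun_plot (p \o i)) -> fun_plot p.
Proof.
by move=> loc i; apply: plot_local => u; have [A [oA [Au pA]]] := loc u;
  exists A, oA; split=> //; exact: pA.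
Qed.

(* the product diffeology on X^I; not the functional diffeology *)
HB.instance Definition _ := isDiffeological.Build R (I -> X)
  fun_plot_cst fun_plot_comp fun_plot_local.
End Fun.

Section Sub.
Variables (X : diffType R) (P : X -> Prop).
Definition sub_plot (U : domain R) (p : U -> {x : X | P x}) : Prop :=
  plot (fun u => sval (p u)).

Fact sub_plot_cst (U : domain R) (z : {x : X | P x}) : sub_plot (fun _ : U => z).
Proof. exact: plot_cst. Qed.

Fact sub_plot_comp (U V : domain R) (f : V -> U) (p : U -> {x : X | P x}) :
  dom_smooth f -> sub_plot p -> sub_plot (p \o f).
Proof. by move=> sf pp; exact: plot_comp pp. Qed.

Fact sub_plot_local (U : domain R) (p : U -> {x : X | P x}) :
  locally_on (fun V i => sub_plot (p \o i)) -> sub_plot p.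
Proof. by move=> loc; exact: plot_local loc. Qed.

HB.instance Definition _ := isDiffeological.Build R {x : X | P x}
  sub_plot_cst sub_plot_comp sub_plot_local.
End Sub.

Section Sum.
Variables (I : Type) (X : I -> diffType R).
Definition sum_plot (U : domain R) (p : U -> {i : I & X i}) : Prop :=
  locally_on (fun V (j : V -> U) => exists i (q : V -> X i),
    plot q /\ forall v, p (j v) = existT _ i (q v)).

Fact sum_plot_cst (U : domain R) (z : {i : I & X i}) : sum_plot (fun _ : U => z).
Proof.
case: z => i x; apply: locally_onW => W j _.
by exists i, (fun=> x); split=> //; exact: plot_cst.
Qed.

Fact sum_plot_comp (U V : domain R) (f : V -> U) (p : U -> {i : I & X i}) :
  dom_smooth f -> sum_plot p -> sum_plot (p \o f).
Proof.
move=> sf; apply: (locally_on_pull sf) => W W' i j g sg e [k [q [pq pE]]].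
exists k, (q \o g); split; first exact: plot_comp pq.
move=> v /=; have /= -> := congr1 (fun h => h v) e; exact: pE.
Qed.

Fact sum_plot_local (U : domain R) (p : U -> {i : I & X i}) :
  locally_on (fun V i => sum_plot (p \o i)) -> sum_plot p.
Proof.
apply: locally_on_join => W W' i g sg [k [q [pq pE]]].
by exists k, (q \o g); split=> [|v]; [exact: plot_comp pq|exact: pE].
Qed.

HB.instance Definition _ := isDiffeological.Build R {i : I & X i}
  sum_plot_cst sum_plot_comp sum_plot_local.
End Sum.

End Constructions.

HB.mixin Record isDiffeologicalGroup (R : realType) G
    of GRing.Zmodule G & Diffeological R G := {
  smooth_add : smooth (fun x : (G * G)%type => x.1 + x.2 : G);
  smooth_opp : smooth (fun x : G => - x) }.

#[short(type="abDiffGroupType")]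
HB.structure Definition AbDiffGroup (R : realType) :=
  {G of GRing.Zmodule G & Diffeological R G & isDiffeologicalGroup R G}.

Section Quotient.
Variables (T : Type) (r : T -> T -> Prop).

Definition gen_equiv : rel {classic T} :=
  fun x y => `[< clos_refl_sym_trans T r x y >].

Fact gen_equiv_refl : reflexive gen_equiv.
Proof. by move=> x; apply/asboolP; exact: rst_refl. Qed.

Fact gen_equiv_sym : symmetric gen_equiv.
Proof. by move=> x y; apply/asboolP/asboolP => ?; exact: rst_sym. Qed.

Fact gen_equiv_trans : transitive gen_equiv.
Proof.
by move=> y x z /asboolP xy /asboolP yz; apply/asboolP; exact: rst_trans yz.
Qed.

Canonical gen_equiv_rel :=
  EquivRel gen_equiv gen_equiv_refl gen_equiv_sym gen_equiv_trans.

(* T modulo the equivalence relation generated by r; cohomologous and         *)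
(* equivariant below are already equivalence relations, refines is not        *)
Definition quotient_by := {eq_quot gen_equiv_rel}%qT.

Definition class_of (x : T) : quotient_by := (\pi_({eq_quot gen_equiv_rel}) (x : {classic T}))%qT.

Lemma class_ofP (x y : T) :
  class_of x = class_of y <-> clos_refl_sym_trans T r x y.
Proof.
by split=> [/eqmodP/asboolP//|xy]; apply/eqmodP/asboolP.
Qed.

End Quotient.
Arguments class_of {T} r x.

(* the map induced by f on the quotients, provided f respects r and r' *)
Definition quotient_map (T T' : Type) (r : T -> T -> Prop)
    (r' : T' -> T' -> Prop) (f : T -> T') (a : quotient_by r) : quotient_by r' :=
  class_of r' (f (repr a)).
Arguments quotient_map {T T'} r r' f a.

Lemma quotient_mapE (T T' : Type) (r : T -> T -> Prop) (r' : T' -> T' -> Prop)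
    (f : T -> T') : (forall x y, r x y -> r' (f x) (f y)) ->
  forall x, quotient_map r r' f (class_of r x) = class_of r' (f x).
Proof.
move=> fr x; apply/class_ofP; suff H y z :
    clos_refl_sym_trans T r y z -> clos_refl_sym_trans T' r' (f y) (f z).
  apply/H/class_ofP; exact: (@reprK _ {eq_quot (gen_equiv_rel r)}%qT).
elim=> {y z} [y z /fr ?|y|y z _ IH|y z w _ IH1 _ IH2].
- exact: rst_step.
- exact: rst_refl.
- exact: rst_sym.
- exact: rst_trans IH2.
Qed.

Section Families.
Context {R : realType}.
Variable X : diffType R.

Record Plot := MkPlot {
  pdom : domain R;
  pmap :> pdom -> X;
  pmapP : plot pmap }.
Arguments pmap : clear implicits.
Arguments pmapP : clear implicits.

Record genFamily := GenFamily {
  members : set Plot;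
  generating : forall p : Plot, locally_on (fun V (i : V -> pdom p) =>
    exists (q : Plot) (f : V -> pdom q),
      [/\ members q, dom_smooth f & forall v, p (i v) = q (f v)]) }.

Implicit Types Q S : genFamily.

(* a generating family is a set of plots, and is indexed by itself *)
Definition fam_index Q := {q : Plot | members Q q}.

Definition nebula Q := {a : fam_index Q & pdom (sval a)}.
HB.instance Definition _ Q := Diffeological.on (nebula Q).

Definition ev Q (y : nebula Q) : X := sval (projT1 y) (projT2 y).
Arguments ev : clear implicits.

Lemma smooth_ev Q : smooth (ev Q).
Proof.
move=> U p pp; apply: plot_local => u.
have [A [oA [Au [a [q [pq pE]]]]]] := pp u; exists A, oA; split=> //.
rewrite (_ : _ \o _ = pmap (sval a) \o q); last first.
  by apply/funext => v; rewrite /= pE.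
exact: plot_comp pq (pmapP _).
Qed.

(* (k+1)-fold fiber product of the nebula over X *)
Definition nerve Q (k : nat) :=
  {y : 'I_k.+1 -> nebula Q | forall i j, ev Q (y i) = ev Q (y j)}.
HB.instance Definition _ Q k := Diffeological.on (nerve Q k).

Fact face_subproof Q k (i : 'I_k.+2) (y : nerve Q k.+1) (j l : 'I_k.+1) :
  ev Q (sval y (lift i j)) = ev Q (sval y (lift i l)).
Proof. exact: (svalP y). Qed.

Definition face Q k (i : 'I_k.+2) (y : nerve Q k.+1) : nerve Q k :=
  exist _ (fun j => sval y (lift i j)) (face_subproof i y).

Record refinement Q S := Refinement {
  ref_idx : fam_index S -> fam_index Q;
  ref_map : forall b : fam_index S, pdom (sval b) -> pdom (sval (ref_idx b));
  ref_smooth : forall b, dom_smooth (@ref_map b);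
  ref_comm : forall b u, sval (ref_idx b) (ref_map u) = sval b u }.

Definition ref_nebula Q S (r : refinement Q S) (y : nebula S) : nebula Q :=
  existT _ (ref_idx r (projT1 y)) (ref_map r (projT2 y)).

Lemma ev_ref_nebula Q S (r : refinement Q S) (y : nebula S) :
  ev Q (ref_nebula r y) = ev S y.
Proof. exact: ref_comm. Qed.

Fact ref_nerve_subproof Q S (r : refinement Q S) k (y : nerve S k) i j :
  ev Q (ref_nebula r (sval y i)) = ev Q (ref_nebula r (sval y j)).
Proof. by rewrite !ev_ref_nebula (svalP y i j). Qed.

Definition ref_nerve Q S (r : refinement Q S) k (y : nerve S k) : nerve Q k :=
  exist _ (fun i => ref_nebula r (sval y i)) (ref_nerve_subproof r y).

Lemma smooth_ref_nebula Q S (r : refinement Q S) : smooth (ref_nebula r).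
Proof.
move=> U p pp u; have [A [oA [Au [b [q [pq pE]]]]]] := pp u.
exists A, oA; split=> //.
exists (ref_idx r b), (@ref_map _ _ r b \o q); split.
  exact: (dom_smooth_comp (pq : dom_smooth q) (ref_smooth r b)).
by move=> v; rewrite /= pE.
Qed.

Lemma smooth_ref_nerve Q S (r : refinement Q S) k : smooth (@ref_nerve Q S r k).
Proof.
by move=> U p pp i; exact: (smooth_ref_nebula r (pp i)).
Qed.

End Families.
Arguments ev {R X} Q y.

Section Cech.
Context {R : realType}.
Variables (X : diffType R) (G : abDiffGroupType R).
Implicit Types Q S : genFamily X.

Definition cobound Q k (f : nerve Q k -> G) (y : nerve Q k.+1) : G :=
  \sum_(i < k.+2) f (face i y) *~ (-1) ^+ i.

Definition cocycle Q k :=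
  {f : nerve Q k -> G | smooth f /\ forall y, cobound f y = 0}.

Definition is_coboundary Q k : (nerve Q k -> G) -> Prop :=
  if k is k'.+1 then fun f =>
    exists h : nerve Q k' -> G, smooth h /\ forall y, f y = cobound h y
  else fun f => forall y, f y = 0.

Definition cohomologous Q k (c c' : cocycle Q k) : Prop :=
  is_coboundary (fun y => sval c y - sval c' y).

(* only the underlying set of the cohomology group; likewise for cechH below *)
Definition famH Q k := quotient_by (@cohomologous Q k).

Lemma cobound_ref Q S (r : refinement Q S) k (f : nerve Q k -> G) y :
  cobound (f \o @ref_nerve _ _ _ _ r k) y = cobound f (ref_nerve r y).
Proof.
apply: eq_bigr => i _; congr (f _ *~ _).
by case: y => y py; exact: eq_exist.
Qed.

Fact pull_cocycle_subproof Q S (r : refinement Q S) k (c : cocycle Q k) :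
  smooth (sval c \o @ref_nerve _ _ _ _ r k) /\
  forall y, cobound (sval c \o @ref_nerve _ _ _ _ r k) y = 0.
Proof.
case: c => f [sf df]; split=> [U p pp|y]; last by rewrite cobound_ref /= df.
exact: (sf _ _ (smooth_ref_nerve r pp)).
Qed.

Definition pull_cocycle Q S (r : refinement Q S) k (c : cocycle Q k) :
  cocycle S k := exist _ _ (pull_cocycle_subproof r c).

Definition pullH Q S (r : refinement Q S) k : famH Q k -> famH S k :=
  quotient_map _ _ (@pull_cocycle Q S r k).

Lemma pullH_class Q S (r : refinement Q S) k (c : cocycle Q k) :
  pullH r (class_of _ c) = class_of _ (pull_cocycle r c).
Proof.
apply: quotient_mapE => {}c c'; rewrite /cohomologous.
case: k c c' => [|k] c c' /=; first by move=> cc' y; exact: cc'.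
move=> [h [sh ch]]; exists (h \o @ref_nerve _ _ _ _ r k); split.
  by move=> U p pp; exact: (sh _ _ (smooth_ref_nerve r pp)).
by move=> y; rewrite cobound_ref -ch.
Qed.

(* a is sent to b by the transition map of some refinement *)
Definition refines k (a b : {Q : genFamily X & famH Q k}) : Prop :=
  exists r : refinement (projT1 a) (projT1 b), pullH r (projT2 a) = projT2 b.

(* colimit over the generating families, the transition maps being all the    *)
(* pullbacks along refinements                                                *)
Definition cechH k := quotient_by (@refines k).

End Cech.

Record diffGroupoid (R : realType) := DiffGroupoid {
  gobj : diffType R;
  garr : diffType R;
  gsrc : garr -> gobj;
  gtgt : garr -> gobj;
  gmul : {gh : garr * garr | gsrc gh.1 = gtgt gh.2} -> garr;
  gunit : gobj -> garr;
  ginv : garr -> garr;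
  smooth_gsrc : smooth gsrc;
  smooth_gtgt : smooth gtgt;
  smooth_gmul : smooth gmul;
  smooth_gunit : smooth gunit;
  smooth_ginv : smooth ginv;
  gsrc_mul : forall gh, gsrc (gmul gh) = gsrc (sval gh).2;
  gtgt_mul : forall gh, gtgt (gmul gh) = gtgt (sval gh).1;
  gmulA : forall g h k e e' e1 e2,
    gmul (exist _ (g, gmul (exist _ (h, k) e)) e1) =
    gmul (exist _ (gmul (exist _ (g, h) e'), k) e2);
  gsrc_unit : forall x, gsrc (gunit x) = x;
  gtgt_unit : forall x, gtgt (gunit x) = x;
  gmul1g : forall g e, gmul (exist _ (gunit (gtgt g), g) e) = g;
  gmulg1 : forall g e, gmul (exist _ (g, gunit (gsrc g)) e) = g;
  gsrc_inv : forall g, gsrc (ginv g) = gtgt g;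
  gtgt_inv : forall g, gtgt (ginv g) = gsrc g;
  gmulVg : forall g e, gmul (exist _ (ginv g, g) e) = gunit (gsrc g);
  gmulgV : forall g e, gmul (exist _ (g, ginv g) e) = gunit (gtgt g) }.

Section RelGroupoid.
Context {R : realType}.
Variables (Y X : diffType R) (f : Y -> X).

Definition fprod := {y : Y * Y | f y.1 = f y.2}.
HB.instance Definition _ := Diffeological.on fprod.

Definition rel_src (y : fprod) : Y := (sval y).2.
Definition rel_tgt (y : fprod) : Y := (sval y).1.

Definition rel_mul (yz : {yz : fprod * fprod | rel_src yz.1 = rel_tgt yz.2}) :
    fprod :=
  exist _ (rel_tgt (sval yz).1, rel_src (sval yz).2)
    (etrans (svalP (sval yz).1)
       (etrans (congr1 f (svalP yz)) (svalP (sval yz).2))).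

Definition rel_unit (y : Y) : fprod := exist _ (y, y) erefl.

Definition rel_inv (y : fprod) : fprod :=
  exist _ ((sval y).2, (sval y).1) (esym (svalP y)).

Lemma fprod_eq (y z : fprod) : rel_tgt y = rel_tgt z -> rel_src y = rel_src z ->
  y = z.
Proof.
case: y z => [[y1 y2] py] [[z1 z2] pz]; rewrite /rel_tgt /rel_src /= => e1 e2.
by apply: eq_exist; rewrite e1 e2.
Qed.

Fact smooth_rel_src : smooth rel_src.
Proof. by move=> U p []. Qed.

Fact smooth_rel_tgt : smooth rel_tgt.
Proof. by move=> U p []. Qed.

Fact smooth_rel_mul : smooth rel_mul.
Proof.
move=> U p [p1 p2]; split.
  exact: (smooth_rel_tgt p1).
exact: (smooth_rel_src p2).
Qed.

Fact smooth_rel_unit : smooth rel_unit.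
Proof. by move=> U p pp; split. Qed.

Fact smooth_rel_inv : smooth rel_inv.
Proof. by move=> U p [p1 p2]; split. Qed.

Definition relGroupoid : diffGroupoid R.
Proof.
refine (@DiffGroupoid R Y fprod rel_src rel_tgt rel_mul rel_unit rel_inv
  smooth_rel_src smooth_rel_tgt smooth_rel_mul smooth_rel_unit smooth_rel_inv
  _ _ _ _ _ _ _ _ _ _ _) => //.
- by move=> *; exact: fprod_eq.
- by move=> *; exact: fprod_eq.
- by move=> *; exact: fprod_eq.
- by move=> *; exact: fprod_eq.
- by move=> *; exact: fprod_eq.
Defined.

End RelGroupoid.

(* e3 and e4 follow from e1, e2, gsrc_mul and act_anchor *)
Record action (R : realType) (H : diffGroupoid R) (Z : diffType R)
    (rho : Z -> gobj H) := Action {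
  act :> {hz : garr H * Z | gsrc hz.1 = rho hz.2} -> Z;
  smooth_anchor : smooth rho;
  smooth_act : smooth act;
  act_anchor : forall hz, rho (act hz) = gtgt (sval hz).1;
  act_mul : forall g h z e1 e2 e3 e4,
    act (exist _ (g, act (exist _ (h, z) e2)) e3) =
    act (exist _ (gmul (exist _ (g, h) e1), z) e4);
  act_unit : forall z e, act (exist _ (gunit (rho z), z) e) = z }.

Section NebulaActions.
Context {R : realType}.
Variables (X : diffType R) (G : abDiffGroupType R) (Q : genFamily X).

Definition trivial_bundle : Type := nebula Q * G.
HB.instance Definition _ := Diffeological.on trivial_bundle.

Definition proj (z : trivial_bundle) : gobj (relGroupoid (ev Q)) := z.1.

Definition rmulG (z : trivial_bundle) (k : G) : trivial_bundle :=
  (z.1, z.2 + k).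

Definition commuting_action :=
  {A : action proj | forall h z k e e',
    A (exist _ (h, rmulG z k) e') = rmulG (A (exist _ (h, z) e)) k}.

Definition equivariant_map (A B : commuting_action)
    (phi : trivial_bundle -> trivial_bundle) : Prop :=
  [/\ smooth phi,
      forall z k, phi (rmulG z k) = rmulG (phi z) k,
      forall z, proj (phi z) = proj z &
      forall h z e e', phi (sval A (exist _ (h, z) e)) =
                       sval B (exist _ (h, phi z) e')].

Definition equivariant (A B : commuting_action) : Prop :=
  exists phi, equivariant_map A B phi.

End NebulaActions.

(* Main.v *)
Require Import Defs.
From Stdlib Require Import Relation_Operators.
From mathcomp Require Import all_boot all_order all_algebra.
From mathcomp Require Import all_classical all_reals.
From mathcomp Require Import topology normedtype derive sequences realfun exp.
From mathcomp Require Import ring lra.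

Set Implicit Arguments.
Unset Strict Implicit.
Unset Printing Implicit Defensive.

Import Order.TTheory GRing.Theory Num.Theory.
Import numFieldNormedType.Exports.

Local Open Scope classical_set_scope.
Local Open Scope ring_scope.

(** Let N be the nebula of Q. An action of R(ev) on N x G commuting with G is
    determined by the element c(y, y') of G by which the arrow (y, y') moves
    (y', 0) to (y, c(y, y')); the axioms of an action say that c is a smooth
    1-cocycle. An equivariant map is determined by the images of the (y, 0), and
    commutes with the actions when it exhibits the two cocycles as cohomologous
    ([equivariantP]). So the actions up to equivariance are the first cohomology
    of Q, and the point is that the map from it to the colimit is bijective.

    A cocycle presents a principal G-bundle over X. A cocycle c of Q and a
    cocycle d of S present isomorphic bundles when there is a smooth h on the
    fiber product of the two nebulae over X that turns c into d ([intertwined]).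
    This is an equivalence relation; it is cohomology when Q = S, and it is
    equality of classes in the colimit ([cech_class_eqP]), because two families
    have a common refinement. Injectivity follows at once.

    For surjectivity, let d be a cocycle of S. A section of the pulled-back bundle
    over each plot of Q gives a cocycle of Q intertwined with d
    ([contractible_trivialization], [trivialization_cocycle]). So everything rests
    on [contractible_section]: over a contractible open set W of R^n, a bundle
    whose structure group is an arbitrary abelian diffeological group has a
    section. The contraction is merely continuous, so the bundle cannot be pulled
    back along it, and functions with values in G cannot be averaged, so local
    sections cannot be glued by a partition of unity. What can be averaged are the
    maps from W to itself. A partition of unity yields smooth maps f_0, f_1, ... from W to W, with f_0
    constant and f_j locally equal to the identity for large j, such that
    f_j(x) and f_(j+1)(x) always lie in a ball over which the bundle is trivial
    ([contraction_steps]). For f and g close in this sense, a section of f^*P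
    gives one of g^*P ([transport_close]): move from f(x) to g(x) along the
    segment, letting only the points of one small set move at a time, so that
    every single move takes place over one trivializing ball ([transport_step]).
    The bundle f_0^*P is constant, hence has a section; transporting it through
    all the f_j gives a section of P itself. *)

(** * Calculus of C^k maps *)

Section CkCalculus.
Context {R : realType}.
Implicit Types V W : normedModType R.

Lemma CkN V W k (U : set V) (f : V -> W) : open U ->
  Ck k U f -> Ck k U (- f).
Proof.
move=> oU; elim: k f => [|k IH] f.
  by move=> cf x Ux; apply: continuousN; exact: cf.
move=> [df Cf]; split=> [x Ux|v]; first by apply: differentiableN; exact: df.
apply: Ck_eq (IH _ (Cf v)) => // x Ux.
by rewrite [LHS]/(- 'D_v f x) deriveN//; apply: diff_derivable; exact: df.
Qed.

Lemma CkB V W k (U : set V) (f g : V -> W) : open U ->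
  Ck k U f -> Ck k U g -> Ck k U (f - g).
Proof. by move=> oU Cf Cg; apply: CkD => //; exact: CkN. Qed.

Lemma CkV V k (U : set V) (f : V -> R) : open U -> (forall x, U x -> f x != 0) ->
  Ck k U f -> Ck k U (fun x => (f x)^-1).
Proof.
move=> oU f0; elim: k => [|k IH].
  by move=> cf x Ux; apply: continuousV; [exact: f0|exact: cf].
move=> Cf; have Cf' := CkW Cf; case: Cf => df Cf; split=> [x Ux|v].
  by apply: differentiableV; [exact: df|exact: f0].
apply: Ck_eq (CkN oU (CkM oU (CkM oU (IH Cf') (IH Cf')) (Cf v))) => // x Ux.
rewrite deriveV; [|exact: f0|by apply: diff_derivable; exact: df].
by rewrite [LHS]/(- ((f x)^-1 * (f x)^-1 * 'D_v f x)) /GRing.scale/= mulNr -exprVn expr2.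
Qed.

Lemma Ck_prod V k n (U : set V) (f : 'I_n -> V -> R) : open U ->
  (forall i, Ck k U (f i)) -> Ck k U (fun x => \prod_(i < n) f i x).
Proof.
move=> oU Cf.
have -> : (fun x => \prod_(i < n) f i x) = \prod_(i < n) f i.
  apply/funext => x; elim/big_ind2 : _ => // a b c d -> ->; by [].
elim/big_ind : _ => //; last by move=> *; exact: CkM.
by apply: Ck_eq (@Ck_cst R V R k U 1) => // x _.
Qed.

Lemma CkZ V k n (U : set V) (s : V -> R) (f : V -> 'rV[R]_n) : open U ->
  Ck k U s -> Ck k U f -> Ck k U (fun x => s x *: f x).
Proof.
move=> oU Cs Cf; apply: Ck_mx => // i.
apply: Ck_eq (CkM oU Cs (Ck_coord i oU Cf)) => // x _.
by rewrite mxE.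
Qed.

End CkCalculus.

(** * Bump functions *)
Section Flat.
Context {R : realType}.

(** The family of the x^(-n) exp(-1/x), extended by 0, is what makes the induction
    in [Ck_flat] work: up to linear combinations it is closed under
    differentiation, whereas exp(-1/x) alone is not. *)
Definition flat (n : nat) (x : R) : R :=
  if 0 < x then x^-1 ^+ n * expR (- x^-1) else 0.

(** Quadratic decay at 0 gives at once continuity and a zero derivative there. It
    comes from y^m <= C exp(y) at y = 1/x and m = n + 2. *)
Lemma flat_bound n : exists2 C : R, 0 <= C & forall x : R, `|flat n x| <= C * x ^+ 2.
Proof.
have p m : exists2 C : R, 0 <= C & forall y, 0 <= y -> y ^+ m <= C * expR y.
  exists (m`!%:R + 1) => // [|y y0]; first by rewrite addr_ge0.
  case: m => [|m].
    rewrite expr0 (le_trans (_ : 1 <= 1 * expR y))//.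
      by rewrite mul1r -expR0 ler_expR.
    by rewrite ler_wpM2r ?expR_ge0// lerDr.
  have := expR_ge1Dxn m y0; have f0 : (0 : R) < m.+1`!%:R by rewrite ltr0n fact_gt0.
  move=> h; rewrite mulrDl mul1r.
  have : y ^+ m.+1 / m.+1`!%:R <= expR y by apply: le_trans h; rewrite lerDr.
  by rewrite ler_pdivrMr// mulrC => h'; apply: (le_trans h'); rewrite lerDl expR_ge0.
have [C C0 hC] := p n.+2; exists C => // x; rewrite /flat; case: ifPn => x0; last first.
  by rewrite normr0 mulr_ge0// sqr_ge0.
have xi : 0 <= x^-1 by rewrite invr_ge0 ltW.
rewrite ger0_norm ?mulr_ge0 ?exprn_ge0 ?expR_ge0// expRN.
rewrite ler_pdivrMr ?expR_gt0// mulrAC.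
have -> : x^-1 ^+ n = x^-1 ^+ n.+2 * x ^+ 2.
  by rewrite -addn2 exprD -mulrA -exprMn mulVf ?gt_eqF// expr1n mulr1.
by rewrite ler_wpM2r ?sqr_ge0// hC.
Qed.

Lemma is_derive_flat n (x : R) :
  is_derive x (1 : R) (flat n) (flat n.+2 x - n%:R * flat n.+1 x).
Proof.
have [x0|x0|->] := ltgtP x 0.
- have E : \near x, (cst 0 : R -> R) x = flat n x.
    near=> y; rewrite /flat ifF//; apply/negbTE; rewrite -leNgt ltW//.
    by near: y; exact: lt_nbhsl.
  apply: near_eq_is_derive E _; rewrite /flat !ltNge (ltW x0)/= mulr0 subr0.
  exact: is_derive_cst.
- have E : \near x, x^-1 ^+ n * expR (- x^-1) = flat n x.
    near=> y; rewrite /flat ifT//.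
    by near: y; exact: lt_nbhsr.
  apply: near_eq_is_derive E _; rewrite /flat x0.
  have xn : x != 0 by rewrite gt_eqF.
  have di := is_deriveV xn (is_derive_id x (1 : R)).
  have de := @is_derive1_comp _ expR (- GRing.inv) x _ _ (is_derive_expR _) (is_deriveN di).
  have dM := is_deriveM (is_deriveX n di) de.
  have -> : (fun y : R => y^-1 ^+ n * expR (- y^-1)) =
      ([eta GRing.inv] ^+ n) * (expR \o - GRing.inv).
    by apply/funext => y /=; rewrite [RHS]/(_ * _) exprfctE.
  apply: is_derive_eq.
  rewrite /= exprfctE /GRing.scale/= !mulr1 -exprVn.
  by case: n {dM} => [|n] /=; rewrite ?exprS ?expr0; ring.
- have f0 m : flat m 0 = 0 by rewrite /flat ltxx.
  rewrite !f0 mulr0 subr0; have [C C0 hC] := flat_bound n.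
  apply/is_derive1_caratheodory; exists (fun z => flat n z / z); split.
  + move=> z; rewrite f0 !subr0; have [->|z0] := eqVneq z 0; last by rewrite divfK.
    by rewrite f0 !mul0r.
  + rewrite /prop_for /continuous_at f0 mul0r; apply/cvgr0Pnorm_lt => e e0.
    have N : \forall z \near (0 : R), `|z| < e / (C + 1).
      by apply: pseudometric_normed_Zmodule.nbhs0_lt; rewrite divr_gt0 ?ltr_wpDl.
    near=> z; apply: (@le_lt_trans _ _ (C * `|z|)).
      have [->|z0] := eqVneq z 0; first by rewrite f0 mul0r normr0 mulr0.
      rewrite normrM normfV ler_pdivrMr ?normr_gt0//.
      by rewrite -mulrA -normrM -expr2 (@ger0_norm _ (z ^+ 2)) ?sqr_ge0 ?hC.
    apply: (@le_lt_trans _ _ ((C + 1) * `|z|)).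
      by rewrite ler_wpM2r// lerDl.
    rewrite mulrC -ltr_pdivlMr ?ltr_wpDl//.
    by near: z; exact: N.
  + by rewrite f0 mul0r.
Unshelve. all: by end_near. Qed.

(** Stated for the composite with f so that the induction on k uses only the chain
    rule for the first derivative of the one-variable function. *)
Lemma Ck_flat (V : normedModType R) k n (U : set V) (f : V -> R) : open U ->
  Ck k U f -> Ck k U (flat n \o f).
Proof.
move=> oU; elim: k n f => [|k IH] n f.
  move=> cf x Ux; apply: continuous_comp; first exact: cf.
  have [+ _] := is_derive_flat n (f x).
  by move=> /derivable1_diffP/differentiable_continuous.
move=> Cf; have Cf' := CkW Cf; case: Cf => df Cf.
have dfl m y : differentiable (flat m) y.
  by apply/derivable1_diffP; case: (is_derive_flat m y).
split=> [x Ux|v]; first by apply: differentiable_comp; [exact: df|exact: dfl].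
pose h := ((flat n.+2 \o f) - cst n%:R * (flat n.+1 \o f)) * 'D_v f.
apply: (@Ck_eq _ _ _ _ _ h) => // [x Ux|]; last first.
  apply: CkM (Cf v) => //; apply: CkB (IH _ _ Cf') _ => //.
  by apply: CkM (IH _ _ Cf') => //; exact: Ck_cst.
have dfx := df x Ux.
rewrite [RHS]deriveE; last exact: differentiable_comp.
rewrite diff_comp//= -(deriveE v dfx) -[in RHS](mulr1 ('D_v f x)).
rewrite -[_ * 1]/('D_v f x *: (1 : R)) linearZ/= -(deriveE _ (dfl n (f x))).
have [_ ->] := is_derive_flat n (f x).
by rewrite /GRing.scale/= mulrC.
Qed.

Lemma flat_gt0 n x : 0 < x -> 0 < flat n x.
Proof. by move=> x0; rewrite /flat x0 mulr_gt0 ?expR_gt0// exprn_gt0 ?invr_gt0. Qed.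

Lemma flat_le0 n x : x <= 0 -> flat n x = 0.
Proof. by rewrite leNgt /flat => /negbTE ->. Qed.

Lemma flat_ge0 n x : 0 <= flat n x.
Proof. by have [/flat_le0->|/(flat_gt0 n)/ltW] := leP x 0. Qed.

(** The two terms of the denominator do not vanish together: the first is positive
    for |x| < 2 and the second for |x| > 1. *)
Definition bump1 (x : R) : R :=
  flat 0 (4 - x ^+ 2) / (flat 0 (4 - x ^+ 2) + flat 0 (x ^+ 2 - 1)).

Let bump1_den x : 0 < flat 0 (4 - x ^+ 2) + flat 0 (x ^+ 2 - 1).
Proof.
have [x2|x2] := ltP (x ^+ 2) 4.
  by rewrite ltr_pwDl ?flat_ge0// flat_gt0// subr_gt0.
by rewrite ltr_wpDl ?flat_ge0// flat_gt0// subr_gt0 (lt_le_trans _ x2)// ltr1n.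
Qed.

Lemma bump1_itv x : 0 <= bump1 x <= 1.
Proof.
have d0 := ltW (bump1_den x).
rewrite /bump1 divr_ge0 ?flat_ge0//= ler_pdivrMr// mul1r lerDl; exact: flat_ge0.
Qed.

Lemma bump1_eq1 x : `|x| <= 1 -> bump1 x = 1.
Proof.
move=> x1; have x2 : x ^+ 2 <= 1 by rewrite -real_normK ?num_real// expr_le1.
rewrite /bump1 (@flat_le0 _ (x ^+ 2 - 1)) ?subr_le0// addr0 divff// gt_eqF//.
by rewrite flat_gt0// subr_gt0 (le_lt_trans x2)// ltr1n.
Qed.

Lemma bump1_eq0 x : 2 <= `|x| -> bump1 x = 0.
Proof.
move=> x2; rewrite /bump1 flat_le0 ?mul0r// subr_le0 -(@real_normK _ x) ?num_real//.
by rewrite (_ : 4 = 2 ^+ 2) ?lerXn2r ?nnegrE// expr2 -natrM.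
Qed.

Lemma Ck_bump1 (V : normedModType R) k (U : set V) (f : V -> R) : open U ->
  Ck k U f -> Ck k U (bump1 \o f).
Proof.
move=> oU Cf; have Cf2 : Ck k U (f * f) by exact: CkM.
have C4 (c : R) : Ck k U (cst c : V -> R) by exact: Ck_cst.
have C1 : Ck k U (flat 0 \o (cst 4 - f * f)) by apply/Ck_flat => //; exact: CkB.
have C2 : Ck k U (flat 0 \o (f * f - cst 1)) by apply/Ck_flat => //; exact: CkB.
apply: Ck_eq (CkM oU C1 (CkV oU _ (CkD oU C1 C2))) => // x _.
by apply/lt0r_neq0; exact: bump1_den.
Qed.

End Flat.

Section Bump.
Context {R : realType} (n : nat).
Implicit Types c x : 'rV[R]_n.

Lemma ball_rowP c (r : R) x : 0 < r ->
  ball c r x <-> forall i, `|c 0 i - x 0 i| < r.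
Proof.
move=> r0; split=> [[_ h] i|h]; first exact: (h 0 i).
by split=> // i j; rewrite ord1; exact: h.
Qed.

Lemma bumpP c (r : R) : 0 < r -> exists b : 'rV[R]_n -> R,
  [/\ forall k, Ck k setT b, forall x, 0 <= b x <= 1,
      forall x, ball c r x -> b x = 1 &
      forall x, ~ ball c (2 * r) x -> b x = 0].
Proof.
move=> r0; have r20 : 0 < 2 * r by rewrite mulr_gt0.
pose t i x := (c 0 i - x 0 i) / r.
have tE i x : `|t i x| = `|c 0 i - x 0 i| / r by rewrite normrM normfV (gtr0_norm r0).
exists (fun x => \prod_(i < n) bump1 (t i x)); split.
- move=> k; apply: (@Ck_prod R _ k n setT (fun i x => bump1 (t i x)) openT) => i.
  apply: (@Ck_bump1 R _ k setT (t i) openT).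
  have Ci : Ck k setT (fun x => x 0 i) by apply: (Ck_coord _ openT); exact: Ck_id.
  by apply: (Ck_eq openT _ (CkM openT (CkB openT (Ck_cst _ _ (c 0 i)) Ci) (Ck_cst _ _ r^-1))).
- move=> x; elim/big_ind : _ => [|y z /andP[y0 y1] /andP[z0 z1]|i _].
  + by rewrite ler01 lexx.
  + by rewrite mulr_ge0// mulr_ile1.
  + exact: bump1_itv.
- move=> x /ball_rowP -/(_ r0) cx; rewrite big1// => i _; apply: bump1_eq1.
  by rewrite tE ler_pdivrMr// mul1r ltW.
- move=> x ncx; have [i hi] : exists i, 2 * r <= `|c 0 i - x 0 i|.
    apply: contrapT => h; apply: ncx; apply/ball_rowP => // i.
    by rewrite ltNge; apply/negP => ?; apply: h; exists i.
  by rewrite (bigD1 i)//= bump1_eq0 ?mul0r// tE ler_pdivlMr.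
Qed.

Lemma dense_ratr_row x (r : R) : 0 < r ->
  exists c : 'rV[rat]_n, ball (map_mx ratr c : 'rV[R]_n) r x.
Proof.
move=> r0; have q i : exists q : rat, `|ratr q - x 0 i| < r.
  have [|q] := @rat_in_itvoo R (x 0 i - r) (x 0 i + r).
    by rewrite ltrD2l gtrN.
  by rewrite in_itv/= => hq; exists q; rewrite ltr_distl.
have [c hc] := choice q; exists (\row_i c i).
by apply/ball_rowP => // i; rewrite !mxE.
Qed.

(** A substitute for a locally finite partition of unity. The balls of rational
    center and radius 1/(m+1) are enumerated through [unpickle]; such a ball is
    kept if its threefold enlargement lies in a small open set, and then carries a
    bump that equals 1 on it. The supports may accumulate; but since some b k equals
    1 near each point, the weights b k * prod_(l < k) (1 - b l) vanish near that
    point from some index on, and they add up to 1. *)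
Lemma bump_cover (U : set 'rV[R]_n) (small : set 'rV[R]_n -> Prop) :
    small set0 ->
    (forall x, U x -> exists O, [/\ open O, O x & small O]) ->
  exists (b : nat -> 'rV[R]_n -> R) (C O : nat -> set 'rV[R]_n),
    [/\ forall k m, Ck m setT (b k), forall k x, 0 <= b k x <= 1,
        forall k x, ~ C k x -> b k x = 0,
        forall k, [/\ closed (C k), open (O k), C k `<=` O k & small (O k)] &
        forall x, U x -> exists k, \near x, b k x = 1].
Proof.
move=> small0 smallU.
pose rad m : R := m.+1%:R^-1; have rad0 m : 0 < rad m by rewrite invr_gt0.
pose fits (c : 'rV[rat]_n) m O := [/\ open O, small O &
  ball (map_mx ratr c : 'rV[R]_n) (3 * rad m) `<=` O].
have P (k : nat) : exists bCO : ('rV[R]_n -> R) * (set 'rV[R]_n * set 'rV[R]_n),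
    let b := bCO.1 in let C := bCO.2.1 in let O := bCO.2.2 in
    [/\ [/\ forall m, Ck m setT b, forall x, 0 <= b x <= 1 &
             forall x, ~ C x -> b x = 0],
        [/\ closed C, open O, C `<=` O & small O] &
        forall (c : 'rV[rat]_n) (m : nat),
          unpickle k = Some (c, m) -> (exists O, fits c m O) ->
          ball (map_mx ratr c : 'rV[R]_n) (rad m) `<=` [set x | b x = 1]].
  have [[c [m [kE [ O [oO sO ballO]]]]]|noO] := pselect
      (exists (c : 'rV[rat]_n) (m : nat),
        unpickle k = Some (c, m) /\ exists O, fits c m O); last first.
    exists (cst 0, (set0, set0)) => /=; split.
    - by split=> [m|x|//]; [exact: Ck_cst|rewrite lexx ler01].
    - by split; [exact: closed0|exact: open0| |].
    - by move=> c m kE hO; case: noO; exists c, m.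
  have [b [Cb b01 b1 b0]] := bumpP (map_mx ratr c : 'rV[R]_n) (rad0 m).
  exists (b, (closed_ball (map_mx ratr c : 'rV[R]_n) (2 * rad m), O)) => /=; split.
  - by split=> // x nx; apply: b0 => cx; apply: nx; exact: subset_closed_ball.
  - split=> //; first exact: closed_ball_closed.
    apply: subset_trans ballO; apply: closed_ball_subset; first by rewrite mulr_gt0.
    by rewrite ltr_pM2r// ltr_nat.
  - by move=> c' m'; rewrite kE => -[<- <-] _ x /b1.
have [f hf] := choice P.
exists (fun k => (f k).1), (fun k => (f k).2.1), (fun k => (f k).2.2).
split=> [k m|k x|k x|k|x Ux].
- by have [[]] := hf k.
- by have [[]] := hf k.
- by have [[_ _ + _ _]] := hf k; apply.
- by have [] := hf k.
have [ O [oO Ox sO]] := smallU x Ux.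
have /nbhs_ballP[e /= e0 eO] := open_nbhs_nbhs (conj oO Ox).
have [m hm] : exists m, 4 * rad m < e.
  (* a ball of radius 1/(m+1) around c contains x, and its enlargement by 3 must
     stay in the ball of radius e around x: hence the factor 4 = 1 + 3 *)
  have [|m] := @ltr_add_invr R 0 (e / 4); first by rewrite divr_gt0.
  by rewrite add0r ltr_pdivlMr// mulrC => hm; exists m.
have [c cx] := dense_ratr_row x (rad0 m).
exists (pickle (c, m)); have [_ _ h] := hf (pickle (c, m)).
have := h c m (pickleK _) => {}h.
have : nbhs x (ball (map_mx ratr c : 'rV[R]_n) (rad m)).
  by apply: open_nbhs_nbhs; split=> //; exact: ball_open.
apply: filterS; apply: h; exists O; split=> // y cy; apply: eO.
apply: le_ball (ltW hm) _ _; rewrite (_ : 4 * rad m = rad m + 3 * rad m); last by ring.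
by apply: ball_triangle cy; exact: ball_sym.
Qed.

End Bump.

(** * Smooth selection from convex sets *)
Lemma open_near (T : topologicalType) (x : T) (P : set T) :
  (\forall y \near x, P y) -> exists W, [/\ open W, W x & W `<=` P].
Proof.
move=> Px; exists P^°; split; [exact: open_interior|exact: Px|exact: interior_subset].
Qed.

Definition convex_mx (R : realType) n (B : set 'rV[R]_n) := forall y z (t : R),
  B y -> B z -> 0 <= t <= 1 -> B (t *: y + (1 - t) *: z).

Lemma convex_ball (R : realType) n (x : 'rV[R]_n) r : convex_mx (ball x r).
Proof.
move=> y z t; rewrite -ball_normE /= => xy xz /andP[t0 t1].
have -> : x - (t *: y + (1 - t) *: z) = t *: (x - y) + (1 - t) *: (x - z).
  by apply/matrixP => i k; rewrite !mxE; ring.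
have := ler_normD (t *: (x - y)) ((1 - t) *: (x - z)).
rewrite !normrZ (ger0_norm t0) ger0_norm ?subr_ge0//.
by have [?|/ltW ?] := leP `|x - y| `|x - z|; nra.
Qed.

Section PartialSums.
Context {R : realType}.

Section Psum.
Variables (T : Type) (b : nat -> T -> R).

(** This is 1 - prod_(l < k) (1 - b l), the sum of the first k weights; it equals 1
    once some b l does. *)
Fixpoint psum (k : nat) (x : T) : R :=
  if k is j.+1 then psum j x + (1 - psum j x) * b j x else 0.

Fixpoint wavg (V : lmodType R) (c : nat -> T -> V) (k : nat) (x : T) : V :=
  if k is j.+1 then wavg c j x + (1 - psum j x) *: (b j x *: c j x) else 0.

Lemma psumS k x : psum k.+1 x = psum k x + (1 - psum k x) * b k x.
Proof. by []. Qed.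

Lemma wavgS (V : lmodType R) (c : nat -> T -> V) k x :
  wavg c k.+1 x = wavg c k x + (1 - psum k x) *: (b k x *: c k x).
Proof. by []. Qed.

Hypothesis b01 : forall k x, 0 <= b k x <= 1.

Lemma psum_itv k x : 0 <= psum k x <= 1.
Proof.
elim: k => [|k /andP[s0 s1]] /=; first by rewrite lexx ler01.
have /andP[b0 b1] := b01 k x; apply/andP; split.
  by rewrite addr_ge0// mulr_ge0// subr_ge0.
rewrite -lerBrDl -[leRHS]mulr1 ler_wpM2l// subr_ge0//.
Qed.

Lemma psum_eq1 k j x : b k x = 1 -> (k < j)%N -> psum j x = 1.
Proof.
move=> bk; elim: j => // j IH; rewrite ltnS leq_eqVlt => /orP[/eqP <-|/IH /= ->].
  by rewrite /= bk mulr1 addrC subrK.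
by rewrite subrr mul0r addr0.
Qed.

End Psum.

Lemma Ck_psum (V : normedModType R) (b : nat -> V -> R) k j :
  (forall j, Ck k setT (b j)) -> Ck k setT (psum b j).
Proof.
move=> Cb; elim: j => [|j IH] /=; first exact: (@Ck_cst R V R k setT 0).
apply: (CkD openT IH); apply: (CkM openT _ (Cb j)).
by apply: (CkB openT _ IH); exact: (@Ck_cst R V R k setT 1).
Qed.

Variables (n m : nat).

Lemma Ck_cutoff k (C O : set 'rV[R]_n) (b : 'rV[R]_n -> R) (c : 'rV[R]_n -> 'rV[R]_m) :
    closed C -> open O -> C `<=` O -> Ck k setT b -> (forall x, ~ C x -> b x = 0) ->
  Ck k O c -> Ck k setT (fun x => b x *: c x).
Proof.
move=> cC oO CO Cb b0 Cc; apply: Ck_local => x _.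
have [Cx|nCx] := pselect (C x).
  by exists O; [exact: CO|apply: CkZ => //; exact: Ck_sub Cb].
have oC : open (~` C) by exact: closed_openC.
exists (~` C) => //; apply: (Ck_eq oC _ (Ck_cst _ _ 0)) => y /b0 ->.
by rewrite scale0r.
Qed.

(** Convex conditions that can be met smoothly near each point can be met smoothly
    everywhere: average the local solutions with the weights above. *)
Theorem smooth_selection (U : set 'rV[R]_n) (Phi : 'rV[R]_n -> set 'rV[R]_m) :
    open U -> (forall x, U x -> convex_mx (Phi x)) ->
    (forall x, U x -> exists O c, [/\ open O, O x, forall k, Ck k O c &
       forall y, O y -> U y -> Phi y (c y)]) ->
  exists f, (forall k, Ck k U f) /\ forall x, U x -> Phi x (f x).
Proof.
move=> oU cvxPhi loc.
pose small O := exists c, (forall k, Ck k O c) /\ forall y, O y -> U y -> Phi y (c y).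
have [|x Ux|b [C [ O [Cb b01 b0 hCO b1]]]] := @bump_cover R n U small.
- by exists (cst 0); split=> // k; exact: Ck_cst.
- by have [ O [c [oO Ox Cc hc]]] := loc x Ux; exists O; split=> //; exists c.
have /choice[c hc] : forall k, exists c : 'rV[R]_n -> 'rV[R]_m,
    (forall j, Ck j (O k) c) /\ forall y, O k y -> U y -> Phi y (c y).
  by move=> k; have [_ _ _] := hCO k.
have Cavg j k : Ck k setT (wavg b c j).
  elim: j => [|j IH] /=; first exact: (@Ck_cst R _ _ k setT 0).
  have [cC oO CO _] := hCO j; apply: (CkD openT IH); apply: (CkZ openT).
    apply: (CkB openT (@Ck_cst R _ R k setT 1)); exact: Ck_psum.
  by apply: Ck_cutoff CO _ _ _ => //; [exact: b0|exact: (hc j).1].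
have stable k j x : b k x = 1 -> (k < j)%N -> wavg b c j x = wavg b c k.+1 x.
  move=> bk; elim: j => // j IH; rewrite ltnS leq_eqVlt => /orP[/eqP <-//|kj].
  by rewrite wavgS (psum_eq1 bk kj) subrr scale0r addr0 IH.
have /choice[K hK] : forall x, exists k, U x -> \near x, b k x = 1.
  by move=> x; have [/b1[k hk]|nU] := pselect (U x); [exists k|exists 0%N].
exists (fun x => wavg b c (K x).+1 x); split=> [k|x Ux].
  apply: Ck_local => x Ux.
  have : \forall y \near x, U y /\ b (K x) y = 1.
    by apply: filterI; [exact: open_nbhs_nbhs (conj oU Ux)|exact: hK x Ux].
  move=> /open_near[W [oW Wx WP]]; exists W => //.
  apply: (Ck_eq oW _ (Ck_sub (@subsetT _ W) (Cavg (K x).+1 k))) => y Wy.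
  have [Uy bKx] := WP y Wy; have bKy : b (K y) y = 1 by exact: nbhs_singleton (hK y Uy).
  by rewrite -(stable _ (maxn (K x) (K y)).+1 _ bKx) ?ltnS ?leq_maxl//
    (stable _ _ _ bKy)// ltnS leq_maxr.
have Phic k : b k x != 0 -> Phi x (c k x).
  move=> bk; apply: (hc k).2 => //; have [_ _ CO _] := hCO k; apply: CO.
  by apply: contrapT => /b0 /eqP; rewrite (negbTE bk).
have bK : b (K x) x = 1 by exact: nbhs_singleton (hK x Ux).
(* The partial average is completed by the missing weight on an arbitrary point of
   Phi x; then each induction step is a convex combination of two points. *)
have avgP k y : Phi x y -> Phi x (wavg b c k x + (1 - psum b k x) *: y).
  elim: k y => [|k IH] y Py; first by rewrite /= subr0 scale1r add0r.
  rewrite wavgS psumS.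
  have [bk0|bk0] := eqVneq (b k x) 0.
    by rewrite bk0 scale0r scaler0 mulr0 !addr0; exact: IH.
  have := IH (b k x *: c k x + (1 - b k x) *: y) (cvxPhi x Ux _ _ _ (Phic k bk0) Py (b01 k x)).
  congr (Phi x _); rewrite -addrA; congr (_ + _).
  by rewrite scalerDr !scalerA; congr (_ + _ *: _); ring.
have := avgP (K x).+1 _ (Phic (K x) _); rewrite (psum_eq1 bK)// subrr scale0r addr0.
by apply; rewrite bK oner_neq0.
Qed.

End PartialSums.

(** * Smoothing a contraction *)
Lemma continuous_nearP (R : realType) (V W : normedModType R) (f : V -> W) (x : V) :
  {for x, continuous f} <->
  forall d, 0 < d -> \forall y \near x, `|f x - f y| < d.
Proof.
rewrite /prop_for /continuous_at; split=> [/cvgrPdist_lt//|h].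
by apply/cvgrPdist_lt.
Qed.

Section Contraction.
Context {R : realType}.
Variables (n : nat) (U : set 'rV[R]_n) (H : 'rV[R]_n * R -> 'rV[R]_n).
Hypothesis oU : open U.
Hypothesis cH : {within U `*` `[0, 1], continuous H}.
Hypothesis HU : forall x t, U x -> 0 <= t <= 1 -> U (H (x, t)).
Variable good : set 'rV[R]_n -> Prop.
Hypothesis goodU : forall x, U x -> exists2 r : R, 0 < r & good (ball x r).

(** The number e is small enough at x for two purposes at once: it bounds a time
    step along the path of x, and the error in approximating that path, so that the
    combined effect of both stays within one good set. *)
Definition tame (x : 'rV[R]_n) (e : R) := forall t : R, 0 <= t <= 1 ->
  exists B, good B /\ forall s : R, 0 <= s <= 1 -> `|t - s| <= e ->
    forall z, `|H (x, s) - z| < e -> B z.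

Lemma tameW x e e' : e' <= e -> tame x e -> tame x e'.
Proof.
move=> e'e h t /h[B [gB hB]]; exists B; split=> // s s01 ts z zs.
by apply: (hB s s01); [exact: le_trans e'e|exact: lt_le_trans e'e].
Qed.

Lemma homotopy_ball x (t d : R) : U x -> 0 <= t <= 1 -> 0 < d ->
  exists2 e : R, 0 < e & forall y (s : R), ball x e y -> `|t - s| < e -> U y ->
    0 <= s <= 1 -> `|H (x, t) - H (y, s)| < d.
Proof.
move=> Ux t01 d0; have xt : (U `*` `[0, 1]) (x, t) by split.
have /= h := (@subspace_continuousP _ _ _ H).1 cH (x, t) xt.
have /= := h _ (nbhsx_ballx (H (x, t)) d d0).
rewrite /within/= => /nbhs_ballP[e /= e0 he].
exists e => // y s xy ts Uy s01.
have ys : ball (x, t) e (y, s) by split=> //=; rewrite -ball_normE.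
by have := he _ ys (conj Uy s01); rewrite -ball_normE.
Qed.

(** Compactness of the time interval: one e serves for all times, and for all
    points near x. *)
Lemma locally_tame x : U x ->
  exists2 e : R, 0 < e & forall y, ball x e y -> U y -> tame y e.
Proof.
move=> Ux.
pose P (e t : R) := forall y, ball x e y -> U y -> 0 <= t <= 1 ->
  exists B, good B /\ forall s : R, 0 <= s <= 1 -> `|t - s| <= e ->
    forall z, `|H (y, s) - z| < e -> B z.
have /compact_near_coveringP/(_ R (0^'+) P) : compact `[0, 1 : R]%classic.
  exact: segment_compact.
move=> cov; have he : \forall e \near (0 : R)^'+, `[0, 1] `<=` P e.
  apply: cov => t; rewrite /= in_itv/= => t01; have [r r0 gr] := goodU (HU Ux t01).
  have r20 : 0 < r / 2 by rewrite divr_gt0.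
  have [d d0 hd] := homotopy_ball Ux t01 r20.
  have d20 : 0 < d / 2 by rewrite divr_gt0.
  have N : \forall e \near (0 : R)^'+, [/\ 0 < e, e < d / 2 & e < r / 2].
    by apply: filterS3 (nbhs_right_gt 0) (nbhs_right_lt d20) (nbhs_right_lt r20).
  exists (ball t (d / 2), [set e | [/\ 0 < e, e < d / 2 & e < r / 2]]).
    by split=> //=; exact: nbhsx_ballx.
  move=> [t1 e] /= [tt1 [e0 ed er]] y xy Uy t101; exists (ball (H (x, t)) r); split=> //.
  move=> s s01 t1s z yz; rewrite -ball_normE/=.
  have {}tt1 : `|t - t1| < d / 2 by move: tt1; rewrite -ball_normE.
  have xy' : ball x d y by apply: le_ball xy; lra.
  have ts : `|t - s| < d by have := ler_distD t1 t s; lra.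
  have := ler_distD (H (y, s)) (H (x, t)) z; have := hd y s xy' ts Uy s01; lra.
have [e [e0 /= {}he]] := filter_ex (filterI (nbhs_right_gt (0 : R)) he).
exists e => // y xy Uy t t01; apply: (he t) => //.
Qed.

(** The admissible e at x form an interval with left end 0, hence a convex set, and
    a constant works locally. *)
Lemma contraction_radius : exists e : 'rV[R]_n -> R,
  (forall k, Ck k U e) /\ forall x, U x -> 0 < e x /\ tame x (e x).
Proof.
have [||f [Cf hf]] := @smooth_selection R n 1 U
    (fun x => [set y : 'rV[R]_1 | 0 < y 0 0 /\ tame x (y 0 0)]) oU.
- move=> x Ux y z t [y0 yt] [z0 zt] /andP[t0 t1]; rewrite /= !mxE.
  (* the larger of the two radii is admissible, hence so is any average *)
  wlog yz : y z t y0 yt z0 zt t0 t1 / y 0 0 <= z 0 0.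
    move=> W; have [yz|/ltW zy] := leP (y 0 0) (z 0 0); first exact: W.
    have := W z y (1 - t); rewrite subKr addrC; apply=> //; lra.
  split; last by apply: tameW zt; nra.
  have [->|tn] := eqVneq t 0; first by rewrite mul0r add0r subr0 mul1r.
  have tp : 0 < t by rewrite lt0r tn.
  by rewrite ltr_pwDl ?mulr_gt0// mulr_ge0 ?subr_ge0// ltW.
- move=> x Ux; have [e e0 he] := locally_tame Ux.
  exists (ball x e), (cst (const_mx e)); split=> [|||y xy Uy].
  + exact: ball_open.
  + exact: ballxx.
  + by move=> k; exact: Ck_cst.
  + by rewrite /= mxE; split=> //; exact: he.
exists (fun x => f x 0 0); split=> [k|x /hf//].
exact: (Ck_coord _ oU (Cf k)).
Qed.

Section Steps.
Variables (x0 : 'rV[R]_n) (e : 'rV[R]_n -> R).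
Hypothesis H0 : forall x, U x -> H (x, 0) = x.
Hypothesis H1 : forall x, U x -> H (x, 1) = x0.
Hypothesis ce : forall x, U x -> {for x, continuous e}.
Hypothesis he : forall x, U x -> 0 < e x /\ tame x (e x).

(** The time reached after j steps of length e x, going from 1 down to 0. A step
    length that depends on x lets every point arrive after finitely many steps,
    although no single length need suit all points. *)
Definition clock (j : nat) (x : 'rV[R]_n) : R := Num.max 0 (1 - j%:R * e x).

Lemma clock_itv j x : U x -> 0 <= clock j x <= 1.
Proof.
move=> /he[e0 _]; rewrite le_max lexx/= ge_max ler01/= gerBl.
by rewrite mulr_ge0// ltW.
Qed.

Lemma clock_step j x : U x -> `|clock j.+1 x - clock j x| <= e x.
Proof.
move=> /he[e0 _]; rewrite /clock -natr1 mulrDl mul1r.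
set a := j%:R * e x.
by case: (ltrP 0 (1 - a)) => ?; case: (ltrP 0 (1 - (a + e x))) => ?; rewrite ler_norml; lra.
Qed.

Lemma continuous_clock j x : U x -> {for x, continuous (clock j)}.
Proof.
move=> Ux; apply: continuous_max; first exact: cst_continuous.
apply: continuousB; first exact: cst_continuous.
by apply: continuousM; [exact: cst_continuous|exact: ce].
Qed.

Lemma continuous_path j x : U x -> {for x, continuous (fun y => H (y, clock j y))}.
Proof.
move=> Ux; apply/continuous_nearP => d d0.
have [r r0 hr] := homotopy_ball Ux (clock_itv j Ux) d0.
have cl := (continuous_nearP _ _).1 (@continuous_clock j x Ux) r r0.
have Un : nbhs x U by exact: open_nbhs_nbhs (conj oU Ux).
have xn : nbhs x (ball x r) by exact: nbhsx_ballx.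
near=> y; apply: hr.
- by near: y; exact: xn.
- by near: y; exact: cl.
- by near: y; exact: Un.
- by apply: clock_itv; near: y; exact: Un.
Unshelve. all: by end_near. Qed.

Lemma clock_eventually0 x : U x ->
  exists N, \forall y \near x, forall j, (N <= j)%N -> clock j y = 0.
Proof.
move=> Ux; have [ex0 _] := he Ux; have ex20 : 0 < e x / 2 by rewrite divr_gt0.
have [N hN] : exists N : nat, 2 / e x <= N%:R.
  by exists (Num.truncn (2 / e x)).+1; rewrite ltW// truncnS_gt.
exists N; have := (continuous_nearP _ _).1 (ce Ux) _ ex20; apply: filterS => y ey j Nj.
have {}ey : e x / 2 < e y by move: ey; rewrite ltr_distlC; lra.
apply/max_idPl; rewrite subr_le0.
have : 2 <= j%:R * e x by rewrite -ler_pdivrMr// (le_trans hN)// ler_nat.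
have := ler0n R j; nra.
Qed.

(** Being within e x of H (x, clock j x) is a convex condition, and so is agreeing
    with x once the clock has stopped. The latter makes the approximations equal
    to the identity at the end, and not only close to it. *)
Lemma path_approximation j : exists f : 'rV[R]_n -> 'rV[R]_n,
  (forall k, Ck k U f) /\ forall x, U x ->
    `|H (x, clock j x) - f x| < e x /\ (clock j x = 0 -> f x = x).
Proof.
apply: (@smooth_selection R n n U (fun x => [set y |
  `|H (x, clock j x) - y| < e x /\ (clock j x = 0 -> y = x)]) oU).
  move=> x Ux y z t [y1 y2] [z1 z2] /andP[t0 t1]; split=> /= [|c0]; last first.
    by rewrite y2// z2// -scalerDl addrC subrK scale1r.
  have := @convex_ball R n (H (x, clock j x)) (e x) y z t.
  by rewrite -ball_normE /=; apply=> //; rewrite t0.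
move=> x Ux; have [e0 _] := he Ux.
suff [c [Cc hx hc]] : exists c : 'rV[R]_n -> 'rV[R]_n, [/\ forall k, Ck k setT c,
    `|H (x, clock j x) - c x| < e x & \forall y \near x, clock j y = 0 -> c y = y].
  have Un : nbhs x U by exact: open_nbhs_nbhs (conj oU Ux).
  have N : \forall y \near x, `|H (y, clock j y) - c y| < e y.
    have d0 : 0 < (e x - `|H (x, clock j x) - c x|) / 3 by rewrite divr_gt0// subr_gt0.
    have ne := (continuous_nearP _ _).1 (ce Ux) _ d0.
    have np := (continuous_nearP _ _).1 (@continuous_path j x Ux) _ d0.
    have nc := (continuous_nearP _ _).1 (Cc 0%N x I) _ d0.
    apply: filterS3 ne np nc => y; set h := H (x, _); set h' := H (y, _) => ne np nc.
    have := ler_distD h h' (c y); have := ler_distD (c x) h (c y).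
    rewrite (distrC h' h); move: ne; rewrite ltr_distlC; lra.
  have [W [oW Wx hW]] := open_near (filterI N hc).
  by exists W, c; split=> // [k|y /hW[]//]; exact: Ck_sub (Cc k).
(* Where the clock has stopped, use the identity; elsewhere it runs on a whole
   neighborhood, the second condition is void there, and a constant will do. *)
have [c0|cn] := eqVneq (clock j x) 0.
  exists id; split; first by move=> k; exact: Ck_id.
    by rewrite c0 H0// subrr normr0.
  by apply: filterS (filterT : nbhs x setT).
exists (cst (H (x, clock j x))); split; [by move=> k; exact: Ck_cst| |].
  by rewrite subrr normr0.
have c0 : 0 < clock j x by rewrite lt0r cn; have /andP[] := clock_itv j Ux.
have := (continuous_nearP _ _).1 (@continuous_clock j x Ux) _ c0.
by apply: filterS => y + yE; rewrite yE subr0 gtr0_norm// ltxx.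
Qed.

(** The approximations at the clock times j and j + 1 differ from points of one path,
    at times at most e x apart, by less than e x: so [tame] puts both in one good
    set. At j = 0 the exact end point is taken, to start from a constant map. *)
Theorem contraction_steps : exists f : nat -> 'rV[R]_n -> 'rV[R]_n,
  [/\ forall j k, Ck k U (f j), forall x, f 0%N x = x0,
      forall j x, U x -> exists B, [/\ good B, B (f j x) & B (f j.+1 x)] &
      forall x, U x -> exists N, \forall y \near x, U y ->
        forall j, (N <= j)%N -> f j y = y].
Proof.
have /choice[g hg] := path_approximation.
pose f j := if j is _.+1 then g j else cst x0.
have fP j x : U x -> `|H (x, clock j x) - f j x| < e x.
  case: j => [|j] Ux; last by have [] := (hg j.+1).2 x Ux.
  by rewrite /clock mul0r subr0 max_r// H1// subrr normr0; case: (he Ux).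
exists f; split=> [[|j] k|//|j x Ux|x Ux].
- exact: Ck_cst.
- exact: (hg j.+1).1.
- have [e0 tx] := he Ux.
  have [B [gB hB]] := tx _ (clock_itv j.+1 Ux); exists B; split=> //.
    by apply: hB (fP j x Ux); [exact: clock_itv|exact: clock_step].
  by apply: hB (fP j.+1 x Ux); rewrite ?clock_itv// subrr normr0 ltW.
have [N hN] := clock_eventually0 Ux; exists N.+1; apply: filterS hN => y hy Uy [//|j] Nj.
have [_ gE] := (hg j.+1).2 y Uy; rewrite /f gE//.
by apply: hy; exact: ltnW.
Qed.

End Steps.

End Contraction.

(** * Plots *)
Lemma dependent_sequence (T : Type) (P : nat -> T -> Prop) (Q : nat -> T -> T -> Prop)
    (x0 : T) : P 0%N x0 ->
    (forall k x, P k x -> exists y, P k.+1 y /\ Q k x y) ->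
  exists s : nat -> T, s 0%N = x0 /\ forall k, P k (s k) /\ Q k (s k) (s k.+1).
Proof.
move=> P0 step.
have /choice[f hf] : forall kx : nat * T, exists y,
    P kx.1 kx.2 -> P kx.1.+1 y /\ Q kx.1 kx.2 y.
  move=> [k x] /=; have [Px|nP] := pselect (P k x); last by exists x.
  by have [y hy] := step k x Px; exists y.
pose s := fix s k := if k is j.+1 then f (j, s j) else x0.
have sP k : P k (s k).
  by elim: k => // k IH; have [] := hf (k, s k) IH.
exists s; split=> // k; split=> //.
by have [] := hf (k, s k) (sP k).
Qed.

Section Plots.
Context {R : realType}.

Lemma dom_smooth_subdom_inc (U : domain R) (A : set 'rV[R]_(ddim U)) (oA : open A) :
  dom_smooth (@subdom_inc R U A oA : subdom oA -> U).
Proof. by exists id; split=> // k; exact: Ck_id. Qed.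

(** A form of the sheaf axiom that does not mention subdomains: smoothness is
    tested on all the smooth maps into the members of an open cover. *)
Lemma plot_near (X : diffType R) (U : domain R) (h : U -> X) :
  (forall u : U, exists A : set 'rV[R]_(ddim U), [/\ open A, A (sval u) &
     forall (V : domain R) (j : V -> U), dom_smooth j -> (forall v, A (sval (j v))) ->
     plot (h \o j)]) -> plot h.
Proof.
move=> loc; apply: plot_local => u; have [A [oA Au hA]] := loc u.
exists A, oA; split=> //; apply: hA; first exact: dom_smooth_subdom_inc.
by move=> v; have [] := svalP v.
Qed.

Lemma dom_smooth_preim (U W : domain R) (g : U -> W) (B : set 'rV[R]_(ddim W)) u :
  dom_smooth g -> open B -> B (sval (g u)) ->
  exists A : set 'rV[R]_(ddim U),
    [/\ open A, A (sval u) & forall v : U, A (sval v) -> B (sval (g v))].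
Proof.
move=> [F [CF Fg]] oB Bu; exists (dset U `&` F @^-1` B); split.
- rewrite openE => x [Ux Bx]; apply: filterI.
    exact: open_nbhs_nbhs (conj (dopen U) Ux).
  by apply: (CF 0%N x Ux); exact: open_nbhs_nbhs (conj oB Bx).
- by split; [exact: svalP|rewrite /= Fg].
- by move=> v [_]; rewrite /= Fg.
Qed.

Variable G : abDiffGroupType R.

Lemma plotD (U : domain R) (f g : U -> G) :
  plot f -> plot g -> plot (fun u => f u + g u).
Proof. by move=> pf pg; exact: (@smooth_add R G U (fun u => (f u, g u))). Qed.

Lemma plotN (U : domain R) (f : U -> G) : plot f -> plot (fun u => - f u).
Proof. by move=> pf; exact: (@smooth_opp R G U f). Qed.

Lemma plotB (U : domain R) (f g : U -> G) :
  plot f -> plot g -> plot (fun u => f u - g u).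
Proof. by move=> pf pg; apply: plotD => //; exact: plotN. Qed.

End Plots.

(** * Bundles with abelian structure group *)
Section LocalLifts.
Context {R : realType}.
Variables (X Z : diffType R) (pi : Z -> X).

(** The lifting property of a subduction; the case of interest is pi = ev. *)
Definition local_lifts := forall (U : domain R) (p : U -> X), plot p ->
  locally_on (fun V (i : V -> U) =>
    exists l : V -> Z, plot l /\ forall v, p (i v) = pi (l v)).

Lemma local_lifts_surj : local_lifts -> forall x, exists z, x = pi z.
Proof.
move=> ll x; pose U := Domain (@openT 'rV[R]_0).
have u : U by exists 0.
have [A [oA [Au [l [_ hl]]]]] := ll U (fun=> x) (plot_cst _ _) u.
by exists (l (exist _ (sval u) (conj Au (svalP u)))).
Qed.

End LocalLifts.

Section Torsor.
Context {R : realType} {X Z : diffType R} {G : abDiffGroupType R}.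
Variable pi : Z -> X.

Definition fib_smooth (Y : diffType R) (A : set Y) (phi : Y -> X) (k : Y -> Z -> G) :=
  forall (U : domain R) (g : U -> Y) (l : U -> Z), plot g -> plot l ->
    (forall u, A (g u)) -> (forall u, phi (g u) = pi (l u)) ->
  plot (fun u => k (g u) (l u)).

(** Given a cocycle d on the fiber product of Z with itself over X, the bundle
    presented by d has as its fiber over x the functions s on the fiber of pi over
    x such that s z' = s z + d z z'. A section over phi : Y -> X thus is a function
    on the fiber product of Y and Z over X; only its values there matter, and it is
    encoded as a function of two variables to avoid proofs of membership. The
    set A restricts the section to a part of Y. *)
Definition section_on (d : Z -> Z -> G) (Y : diffType R) (A : set Y) (phi : Y -> X)
    (sigma : Y -> Z -> G) :=
  fib_smooth A phi sigma /\
  forall y z z', A y -> phi y = pi z -> phi y = pi z' ->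
    sigma y z' = sigma y z + d z z'.

(** Read with phi = pi and sigma = d, the equation of a section is the cocycle
    identity: a cocycle is the tautological section of its own bundle over Z. *)
Definition fib_cocycle (d : Z -> Z -> G) := section_on d setT pi d.

Hypothesis ll : local_lifts pi.
Variable d : Z -> Z -> G.

(** The difference of two sections has the same value at all the points z of a
    fiber. So it is a function with values in G on Y, and it is smooth even if z is
    chosen without regard to smoothness: locally z may be replaced by a smooth
    lift. *)
Lemma section_diff_plot (Y : diffType R) (A : set Y) (phi : Y -> X) s s'
    (U : domain R) (g : U -> Y) (z : U -> Z) :
  section_on d A phi s -> section_on d A phi s' ->
  plot g -> plot (phi \o g) -> (forall u, A (g u)) ->
  (forall u, phi (g u) = pi (z u)) ->
  plot (fun u => s (g u) (z u) - s' (g u) (z u)).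
Proof.
move=> [ss sd] [ss' sd'] pg pphi Ag zP; apply: plot_local => u.
have [A' [oA' [A'u [l [pl hl]]]]] := ll pphi u; exists A', oA'; split=> //.
set i := @subdom_inc _ _ _ _ in hl *.
have {}hl v : phi (g (i v)) = pi (l v) by exact: hl.
have pgi : plot (g \o i) by apply: plot_comp pg; exact: dom_smooth_subdom_inc.
have -> : (fun u => s (g u) (z u) - s' (g u) (z u)) \o i =
          (fun v => s (g (i v)) (l v) - s' (g (i v)) (l v)).
  apply/funext => v /=; rewrite (sd _ (l v) (z (i v))) ?(sd' _ (l v) (z (i v)))//.
  by rewrite opprD addrACA subrr addr0.
by apply: plotB; [apply: (ss _ (g \o i) l)|apply: (ss' _ (g \o i) l)] => // v;
  exact: Ag.
Qed.

Lemma section_comp (Y Y' : diffType R) (A : set Y) (A' : set Y') (phi : Y -> X)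
    (f : Y' -> Y) s :
  smooth f -> (forall y, A' y -> A (f y)) -> section_on d A phi s ->
  section_on d A' (phi \o f) (s \o f).
Proof.
move=> sf AA' [ss sd]; split=> [U g l pg pl Ag fib|y z z' Ay yz yz']; last first.
  by apply: sd => //; exact: AA'.
by apply: (ss U (f \o g) l) => // [|u]; [exact: sf|exact: AA'].
Qed.

Section Transport.
Variables (W : domain R) (p : W -> X).
Hypothesis pp : plot p.

Notation torsor A f := (section_on d A (p \o f)).

(** Write P for the bundle pulled back to W along p. Over O both f and g take values
    where P has the section tau. There a section of
    f^*P is f^*tau plus a function delta with values in G, and g^*tau + delta is a
    section of g^*P. Where f = g it is the section one started from, so
    outside of C nothing has to be changed, and the two descriptions agree on the
    overlap of O and the complement of C. *)
Lemma transport_step (f g : W -> W) (O C B : set 'rV[R]_(ddim W)) tau e :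
    dom_smooth f -> dom_smooth g -> open O -> closed C -> C `<=` O ->
    (forall u : W, ~ C (sval u) -> f u = g u) ->
    section_on d [set u : W | B (sval u)] p tau ->
    (forall u : W, O (sval u) -> B (sval (f u)) /\ B (sval (g u))) ->
    torsor setT f e ->
  exists e', torsor setT g e' /\
    forall u z, f u = g u -> p (f u) = pi z -> e' u z = e u z.
Proof.
move=> sf sg oO cC CO fg tauP OB eP.
have [rep repP] := choice (local_lifts_surj ll).
have [ts td] := tauP; have [es ed] := eP.
pose delta u := e u (rep (p (f u))) - tau (f u) (rep (p (f u))).
pose e' u z := if `[< O (sval u) >] then tau (g u) z + delta u else e u z.
have e'O (u : W) z : O (sval u) -> e' u z = tau (g u) z + delta u.
  by move=> /asboolP; rewrite /e' => ->.
have e'E (u : W) z : f u = g u -> p (f u) = pi z -> e' u z = e u z.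
  move=> fgu pz; rewrite /e'; case: asboolP => // Ou; rewrite -fgu /delta.
  rewrite (ed u z (rep (p (f u))))// (td (f u) z (rep (p (f u))))//; last exact: (OB u Ou).1.
  by rewrite opprD addrACA subrr addr0 addrCA subrr addr0.
exists e'; split=> //; split=> [U a l pa pl _ fib|u z z' _ /= uz uz']; last first.
  have [Ou|nO] := pselect (O (sval u)).
    by rewrite !e'O// (td (g u) z z')// 1?addrAC//; exact: (OB u Ou).2.
  have fgu : f u = g u by apply: fg => Cu; apply: nO; exact: CO.
  by rewrite !e'E ?fgu//; apply: ed; rewrite //= fgu.
have {}fib v : p (g (a v)) = pi (l v) by exact: fib.
apply: plot_near => v; have [Ov|nOv] := pselect (O (sval (a v))).
  have [A [oA Av AO]] := dom_smooth_preim pa oO Ov.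
  exists A; split=> // V j sj Aj.
  have paj : dom_smooth (a \o j) by exact: dom_smooth_comp pa.
  have pfa : plot (f \o (a \o j)) by exact: dom_smooth_comp sf.
  have pga : plot (g \o (a \o j)) by exact: dom_smooth_comp sg.
  have Oj v' : O (sval (a (j v'))) by exact: AO.
  rewrite (_ : _ \o j = fun v' => tau (g (a (j v'))) (l (j v')) + delta (a (j v'))); last first.
    by apply/funext => v' /=; rewrite e'O.
  apply: plotD.
    apply: (ts V (g \o (a \o j)) (l \o j)) => //=; first exact: plot_comp pl.
    by move=> v'; exact: (OB _ (Oj v')).2.
  have tf : section_on d [set u : W | O (sval u)] (p \o f) (tau \o f).
    apply: (@section_comp W W [set u : W | B (sval u)] _ p f) tauP.
      by move=> V' q pq; exact: dom_smooth_comp sf.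
    by move=> u Ou; exact: (OB u Ou).1.
  have ef : section_on d [set u : W | O (sval u)] (p \o f) e.
    by apply: (@section_comp W W setT _ (p \o f) id) eP.
  apply: (section_diff_plot (z := fun v' => rep (p (f (a (j v'))))) ef tf paj) => //.
  exact: (@plot_comp R X W V (f \o (a \o j)) p pfa pp).
have nC : (~` C) (sval (a v)) by move=> Cv; apply: nOv; exact: CO.
have [A [oA Av AC]] := dom_smooth_preim pa (closed_openC cC) nC.
exists A; split=> // V j sj Aj.
rewrite (_ : _ \o j = fun v' => e (a (j v')) (l (j v'))).
  apply: (es V (a \o j) (l \o j)) => //; [exact: dom_smooth_comp pa|exact: plot_comp pl|].
  by move=> v' /=; rewrite (fg _ (AC _ (Aj v'))).
by apply/funext => v' /=; rewrite e'E ?(fg _ (AC _ (Aj v'))).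
Qed.

(** Where the maps fs k have become stationary, so have the sections, because the
    transport does not change a section at the points that do not move. *)
Lemma transport_limit (fs : nat -> W -> W) (es : nat -> W -> Z -> G) (g : W -> W) :
    (forall k, torsor setT (fs k) (es k)) ->
    (forall k u z, fs k u = fs k.+1 u -> p (fs k u) = pi z -> es k.+1 u z = es k u z) ->
    (forall u : W, exists K (A : set 'rV[R]_(ddim W)), [/\ open A, A (sval u) &
       forall u' : W, A (sval u') -> forall k, (K <= k)%N -> fs k u' = g u']) ->
  exists e, torsor setT g e /\
    forall u z K, (forall k, (K <= k)%N -> fs k u = g u) -> p (g u) = pi z ->
      e u z = es K u z.
Proof.
move=> esP step ev.
have stable u z K j : (forall k, (K <= k)%N -> fs k u = g u) -> p (g u) = pi z ->
    (K <= j)%N -> es j u z = es K u z.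
  move=> fK gz; elim: j => [|j IH]; first by rewrite leqn0 => /eqP <-.
  rewrite leq_eqVlt => /orP[/eqP <-//|]; rewrite ltnS => Kj.
  by rewrite step ?IH// !fK// ltnW.
have [K hK] := choice ev; pose e u z := es (K u) u z.
have eE u z j : (forall k, (j <= k)%N -> fs k u = g u) -> p (g u) = pi z ->
    e u z = es j u z.
  move=> fj gz; have [A [_ Au hA]] := hK u.
  rewrite -(stable u z j (maxn j (K u)))// ?leq_maxl// /e.
  by rewrite -(stable u z (K u) (maxn j (K u)))// ?leq_maxr//; exact: hA.
exists e; split=> //; split=> [U a l pa pl _ fib|u z z' _ /= uz uz']; last first.
  have [A [_ Au hA]] := hK u; have fu := hA u Au _ (leqnn _).
  by apply: (esP (K u)).2; rewrite //= fu.
have {}fib v : p (g (a v)) = pi (l v) by exact: fib.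
apply: plot_near => v; have [A [oA Av hA]] := hK (a v).
have [A' [oA' A'v AA']] := dom_smooth_preim pa oA Av.
exists A'; split=> // V j sj Aj.
rewrite (_ : _ \o j = fun v' => es (K (a v)) (a (j v')) (l (j v'))).
  apply: ((esP (K (a v))).1 V (a \o j) (l \o j)) => //;
    [exact: dom_smooth_comp pa|exact: plot_comp pl|].
  by move=> v' /=; rewrite hA//; exact: AA'.
by apply/funext => v' /=; apply: eE => //; apply: hA; exact: AA'.
Qed.

(** Convexity lets the segment from f u to g u stay in B. *)
Definition trivializing (B : set 'rV[R]_(ddim W)) :=
  [/\ convex_mx B, B `<=` dset W &
      exists tau, section_on d [set u : W | B (sval u)] p tau].

(** A local lift l of p gives the local section d (l _). *)
Lemma trivializing_ball (u : W) : fib_cocycle d ->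
  exists2 r : R, 0 < r & trivializing (ball (sval u) r).
Proof.
move=> [ds dd]; have [A [oA [Au [l [pl hl]]]]] := ll pp u.
have oAW := dopen (subdom oA).
have oAu : open_nbhs (sval u) (dset (subdom oA)) by split=> //; split; [|exact: svalP].
have /nbhs_ballP[r /= r0 rA] := open_nbhs_nbhs oAu.
exists r => //; split; [exact: convex_ball|by move=> x /rA[]|].
exists (fun v z => if pselect (dset (subdom oA) (sval v)) is left h
                   then d (l (exist _ _ h)) z else 0); split.
  move=> U g k pg pk gB fib.
  have gA v : dset (subdom oA) (sval (g v)) by apply: rA; exact: gB.
  pose g' v : subdom oA := exist _ _ (gA v).
  rewrite (_ : (fun _ => _) = fun v => d (l (g' v)) (k v)); last first.
    apply/funext => v; case: pselect => [h|/(_ (gA v))//].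
    by congr (d (l _) _); exact: dom_eq.
  have pg' : dom_smooth g'.
    by have [F [CF Fg]] := pg; exists F.
  apply: (ds U (l \o g') k) => // [|v]; first exact: (@plot_comp R Z _ _ g' l).
  rewrite /= -hl -fib; congr (p _); exact: dom_eq.
move=> v z z' Bv /= vz vz'; case: pselect => [h|/(_ (rA _ Bv))//].
have e : pi (l (exist _ _ h)) = p v by rewrite -hl; congr p; exact: dom_eq.
by apply: dd; rewrite // e.
Qed.

(** The maps f + s_k (g - f), where s_k is the sum of the first k weights of a
    cover, go from f to g. Two consecutive ones differ only on the support of the
    k-th bump, over which f and g take values in one trivializing convex set; so
    [transport_step] applies at each step, and [transport_limit] at the end. *)
Lemma transport_close (f g : W -> W) e :
    dom_smooth f -> dom_smooth g ->
    (forall u, exists B, [/\ trivializing B, open B, B (sval (f u)) & B (sval (g u))]) ->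
    torsor setT f e ->
  exists e', torsor setT g e' /\
    forall u z, f u = g u -> p (f u) = pi z -> e' u z = e u z.
Proof.
move=> sf sg close eP.
pose small O := exists B, trivializing B /\
  forall u : W, O (sval u) -> B (sval (f u)) /\ B (sval (g u)).
have [|x Wx|b [C [ O [Cb b01 b0 hCO b1]]]] := @bump_cover R _ (dset W) small.
- exists set0; split=> //; split=> [y z t []|x []|].
  exists (fun _ _ => 0); split=> [U a l _ _ _ _|y z z' []].
  exact: plot_cst.
- have [B [tB oB Bf Bg]] := close (exist _ x Wx).
  have [A [oA Ax AB]] := dom_smooth_preim sf oB Bf.
  have [A' [oA' A'x AB']] := dom_smooth_preim sg oB Bg.
  exists (A `&` A'); split; [exact: openI|by []|].
  by exists B; split=> // u [/AB ? /AB'].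
have /choice[B hB] : forall k, exists B, trivializing B /\
    forall u : W, O k (sval u) -> B (sval (f u)) /\ B (sval (g u)).
  by move=> k; have [_ _ _] := hCO k.
pose path k (u : W) :=
  psum b k (sval u) *: sval (g u) + (1 - psum b k (sval u)) *: sval (f u).
have pathB k (u : W) D : convex_mx D -> D (sval (f u)) -> D (sval (g u)) -> D (path k u).
  by move=> cD Df Dg; apply: cD => //; exact: psum_itv.
have pathW k u : dset W (path k u).
  by have [D [[cD DW _] _ Df Dg]] := close u; apply: DW; exact: pathB.
pose fs k (u : W) : W := exist _ _ (pathW k u).
have fsE k u : sval (fs k u) = path k u by [].
have sfs k : dom_smooth (fs k).
  have [F [CF Ff]] := sf; have [F' [CF' Fg]] := sg.
  exists (fun x => psum b k x *: F' x + (1 - psum b k x) *: F x); split=> [m|u]; last first.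
    by rewrite Ff Fg.
  have Cp : Ck m (dset W) (psum b k) by apply: (Ck_sub (@subsetT _ _)); exact: Ck_psum.
  apply: (CkD (dopen W)); apply: (CkZ (dopen W)) => //.
  exact: (CkB (dopen W) (@Ck_cst R _ R m _ 1)).
have fs0 : fs 0%N = f.
  by apply/funext => u; apply: dom_eq; rewrite fsE /path /= scale0r add0r subr0 scale1r.
have [||es [es0 esP]] := @dependent_sequence _ (fun k => torsor setT (fs k))
    (fun k e e' => forall u z, fs k u = fs k.+1 u -> p (fs k u) = pi z -> e' u z = e u z) e.
- by rewrite fs0.
- move=> k ek; have [cC oO CO _] := hCO k; have [[cB BW [tau htau]] OB] := hB k.
  apply: (transport_step (sfs k) (sfs k.+1) oO cC CO _ htau) => u.
    by move=> /b0 bu; apply: dom_eq; rewrite !fsE /path psumS bu mulr0 addr0.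
  by move=> /OB[Bf Bg]; split; rewrite fsE; exact: pathB.
have [|k|u|e' [e'P e'E]] := @transport_limit fs es g.
- by move=> k; have [] := esP k.
- by have [_] := esP k.
- have [k] := b1 _ (svalP u); move=> /open_near[A [oA Au hA]].
  exists k.+1, A; split=> // u' /hA bu' j kj; apply: dom_eq.
  by rewrite fsE /path (psum_eq1 bu' kj) scale1r subrr scale0r addr0.
exists e'; split=> // u z fg pz.
rewrite (e'E u z 0%N) ?es0 -?fg// => k _; apply: dom_eq.
by rewrite fsE /path -fg -scalerDl addrC subrK scale1r.
Qed.

Theorem contractible_section : fib_cocycle d -> contractible W ->
  exists e, section_on d setT p e.
Proof.
move=> dP [H [x0 [cH Wx0 HW H0 H1]]].
pose good B := trivializing B /\ open B.
have goodW x : dset W x -> exists2 r : R, 0 < r & good (ball x r).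
  move=> Wx; have [r r0 tr] := trivializing_ball (exist _ x Wx) dP.
  by exists r => //; split=> //; exact: ball_open.
have [e [Ce he]] := contraction_radius (dopen W) cH HW goodW.
have [f [Cf f0 fB fev]] := contraction_steps (dopen W) cH H0 H1 (Ce 0%N) he.
have fW j x : dset W x -> dset W (f j x).
  by move=> Wx; have [B [[[_ BW _] _] Bf _]] := fB j x Wx; exact: BW.
pose fs j (u : W) : W := exist _ _ (fW j _ (svalP u)).
have sfs j : dom_smooth (fs j) by exists (f j).
have [z0 z0P] := local_lifts_surj ll (p (exist _ x0 Wx0)).
have fs0 u : fs 0%N u = exist _ x0 Wx0 by apply: dom_eq; rewrite /= f0.
have [||es [es0 esP]] := @dependent_sequence _ (fun k => torsor setT (fs k))
    (fun k e e' => forall u z, fs k u = fs k.+1 u -> p (fs k u) = pi z -> e' u z = e u z)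
    (* the constant section, over the point to which W contracts *)
    (fun _ z => d z0 z).
- have [ds dd] := dP; split=> [U a l pa pl _ fib|u z z' _ /=].
    apply: (ds U (fun=> z0) l) => // [|u]; first exact: plot_cst.
    by rewrite -z0P -fib /= fs0.
  by rewrite fs0 z0P => uz uz'; apply: dd.
- move=> k ek; apply: (transport_close (sfs k) (sfs k.+1)) => // u.
  by have [B [[tB oB] Bf Bg]] := fB k _ (svalP u); exists B.
have [|k|u|e' [e'P _]] := @transport_limit fs es id.
- by move=> k; have [] := esP k.
- by have [_] := esP k.
- have [N] := fev _ (svalP u); move=> /open_near[A [oA Au hA]].
  exists N, A; split=> // u' Au' k Nk; apply: dom_eq.
  by rewrite /= (hA _ Au' (svalP u')).
by exists e'.
Qed.

End Transport.

End Torsor.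

(** * Generating families *)
Section Nebulae.
Context {R : realType} {X : diffType R}.
Implicit Types Q S : genFamily X.

Lemma plot_nebula Q (a : fam_index Q) (V : domain R) (f : V -> pdom (sval a)) :
  dom_smooth f -> plot (fun v => existT _ a (f v) : nebula Q).
Proof.
move=> sf; apply: locally_onW => W i si; exists a, (f \o i); split=> //.
exact: dom_smooth_comp sf.
Qed.

Lemma ev_local_lifts Q : local_lifts (ev Q).
Proof.
move=> U p pp u; have [A [oA [Au [q [f [Qq sf pE]]]]]] := @generating R X Q (MkPlot pp) u.
exists A, oA; split=> //.
exists (fun v => existT _ (exist _ q Qq : fam_index Q) (f v)); split.
  exact: (@plot_nebula Q (exist _ q Qq) _ f).
exact: pE.
Qed.

Lemma ev_surj Q x : exists y, x = ev Q y.
Proof. exact: local_lifts_surj (@ev_local_lifts Q) x. Qed.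

Lemma refinement_exists Q S :
  (forall b : fam_index S, exists (a : fam_index Q) (f : pdom (sval b) -> pdom (sval a)),
    dom_smooth f /\ forall u, sval a (f u) = sval b u) ->
  inhabited (refinement Q S).
Proof.
move=> h; pose a b := projT1 (cid (h b)); pose f b := projT1 (cid (projT2 (cid (h b)))).
have fP b : dom_smooth (f b) /\ forall u, sval (a b) (f b u) = sval b u.
  exact: projT2 (cid (projT2 (cid (h b)))).
by split; exact: (@Refinement R X Q S a f (fun b => (fP b).1) (fun b => (fP b).2)).
Qed.

(** The plots that factor through a member of Q and through a member of S form a
    generating family: refine a factorization through Q by one through S. *)
Lemma common_refinement Q S :
  exists T, inhabited (refinement Q T) /\ inhabited (refinement S T).
Proof.
pose factors (F : genFamily X) (p : Plot X) := exists (q : Plot X) (f : pdom p -> pdom q),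
  [/\ members F q, dom_smooth f & forall u, q (f u) = p u].
have gen p : locally_on (fun V (i : V -> pdom p) => exists (q : Plot X) (f : V -> pdom q),
    [/\ factors Q q /\ factors S q, dom_smooth f & forall v, p (i v) = q (f v)]).
  apply: locally_on_join => [V V' i g sg [q [f [mq sf E]]]|].
    by exists q, (f \o g); split=> // [|v]; [exact: dom_smooth_comp sf|exact: E].
  move=> u; have [A [oA [Au [q [f [Qq sf pE]]]]]] := @generating R X Q p u.
  exists A, oA; split=> // w.
  have sA := dom_smooth_subdom_inc oA.
  pose pA := MkPlot (@plot_comp R X _ _ _ p sA (pmapP p)).
  have [B [oB [Bw [s [g [Ss sg sE]]]]]] := @generating R X S pA w.
  exists B, oB; split=> //.
  have sB := dom_smooth_subdom_inc oB.
  pose pB := MkPlot (@plot_comp R X _ _ _ pA sB (pmapP pA)).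
  exists pB, id; split; [|exact: dom_smooth_id|by []]; split.
    exists q, (f \o @subdom_inc _ _ _ oB).
    by split=> // [|v]; [exact: dom_smooth_comp sB sf|rewrite /= -pE].
  by exists s, g; split=> // v; rewrite /= -sE.
pose T := @GenFamily R X [set q | factors Q q /\ factors S q] gen.
exists T; split; apply: refinement_exists => b.
  by have [[q [f [Qq sf fE]]] _] := svalP b; exists (exist _ q Qq), f.
by have [_ [q [f [Qq sf fE]]]] := svalP b; exists (exist _ q Qq), f.
Qed.

End Nebulae.

(** * Cocycles and their classes in the colimit *)
Section Quotients.
Variables (T : Type) (r : T -> T -> Prop).

Lemma class_of_repr (a : quotient_by r) : class_of r (repr a) = a.
Proof. exact: (@reprK _ {eq_quot (gen_equiv_rel r)}%qT). Qed.

Lemma class_of_sub (r' : T -> T -> Prop) x y :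
    (forall x, r' x x) -> (forall x y, r' x y -> r' y x) ->
    (forall x y z, r' x y -> r' y z -> r' x z) ->
    (forall x y, r x y -> r' x y) ->
  class_of r x = class_of r y -> r' x y.
Proof.
move=> rr rs rt sub /class_ofP; elim=> {x y} [x y /sub//|//|x y _ /rs//|x y z _ xy _].
exact: rt xy.
Qed.

End Quotients.

Section Intertwiners.
Context {R : realType} {X : diffType R} {G : abDiffGroupType R}.
Implicit Types Q S T : genFamily X.

(** An isomorphism from the bundle presented by d to the one presented by d',
    written in the trivializations over the two nebulae. In its second variable h is a
    section of the bundle of d' over the nebula of Q; the second clause is the
    change of trivialization in the first variable. *)
Definition intertwined Q S
    (d : nebula Q -> nebula Q -> G) (d' : nebula S -> nebula S -> G) :=
  exists h : nebula Q -> nebula S -> G, section_on (ev S) d' setT (ev Q) h /\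
    forall y y' z, ev Q y = ev Q y' -> ev Q y = ev S z -> h y z = d y y' + h y' z.

Lemma intertwined_refl Q (d : nebula Q -> nebula Q -> G) :
  fib_cocycle (ev Q) d -> intertwined d d.
Proof.
move=> dP; exists d; split=> // y y' z yy' yz.
by case: dP => _ dP; apply: dP.
Qed.

Lemma intertwined_sym Q S
    (d : nebula Q -> nebula Q -> G) (d' : nebula S -> nebula S -> G) :
  intertwined d d' -> intertwined d' d.
Proof.
move=> [h [[sh hd'] hd]]; exists (fun z y => - h y z); split; [split|].
- by move=> U g l pg pl _ fib; apply: plotN; apply: sh.
- move=> z y y' _ zy zy'; rewrite (hd y y' z) -?zy// opprD addrAC addNr add0r//.
- by move=> z z' y zz' zy; rewrite (hd' y z z') -?zy// opprD addrCA subrr addr0.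
Qed.

(** The composite is h y z + k z w, which is the same for all z over the given
    point; so z can be lifted smoothly near each point when smoothness is tested. *)
Lemma intertwined_trans Q S T (d : nebula Q -> nebula Q -> G)
    (d' : nebula S -> nebula S -> G) (d'' : nebula T -> nebula T -> G) :
  intertwined d d' -> intertwined d' d'' -> intertwined d d''.
Proof.
move=> [h [[sh hd'] hd]] [k [[sk kd''] kd']].
have [rep repP] := choice (@ev_surj R X S).
pose m y w := h y (rep (ev Q y)) + k (rep (ev Q y)) w.
have mE y w z : ev Q y = ev T w -> ev Q y = ev S z -> m y w = h y z + k z w.
  move=> yw yz; rewrite /m (hd' y z (rep (ev Q y)))// (kd' z (rep (ev Q y)) w) -?yz//.
  by rewrite addrA.
exists m; split; [split|].
- move=> U g l pg pl _ fib; apply: plot_local => u.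
  have [A [oA [Au [z [pz hz]]]]] := @ev_local_lifts R X S U _ (@smooth_ev _ _ Q _ _ pg) u.
  exists A, oA; split=> //; set i := @subdom_inc _ _ _ _ in hz *.
  have {}hz v : ev Q (g (i v)) = ev S (z v) by exact: hz.
  have si : dom_smooth i by exact: dom_smooth_subdom_inc.
  rewrite (_ : _ \o i = fun v => h (g (i v)) (z v) + k (z v) (l (i v))); last first.
    by apply/funext => v /=; rewrite (mE _ _ (z v)).
  apply: plotD; first by apply: (sh _ (g \o i) z) => //; exact: plot_comp pg.
  apply: (sk _ z (l \o i)) => //; first exact: plot_comp pl.
  by move=> v /=; rewrite -hz fib.
- move=> y w w' _ yw yw'; have yz := repP (ev Q y).
  by rewrite (mE y w' _ yw' yz) (mE y w _ yw yz) (kd'' _ w w') -?yz// addrA.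
- move=> y y' w yy' yw; have yz := repP (ev Q y).
  by rewrite (mE y w _ yw yz) (mE y' w (rep (ev Q y))) -?yy'// (hd y y')// addrA.
Qed.

Definition cohomologous_by Q (d d' : nebula Q -> nebula Q -> G) (m : nebula Q -> G) :=
  smooth m /\ forall y y', ev Q y = ev Q y' -> d y y' + m y = d' y y' + m y'.

(** When the two families agree, minus the restriction of h to the diagonal is the
    cochain that relates the cocycles. *)
Lemma intertwinedP Q (d d' : nebula Q -> nebula Q -> G) : fib_cocycle (ev Q) d' ->
  intertwined d d' <-> exists m, cohomologous_by d d' m.
Proof.
move=> [sd' dd']; split=> [[h [[sh hd'] hd]]|[m [sm md]]].
  exists (fun y => - h y y); split=> [U p pp|y y' yy'].
    by apply: plotN; apply: sh.
  by rewrite (hd' y' y y')// (hd y y' y)// !opprD addrA subrr add0r addrC addrNK.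
exists (fun y z => d' y z - m y); split; [split|].
- by move=> U g l pg pl _ fib; apply: plotB; [exact: sd'|exact: sm].
- by move=> y z z' _ yz yz'; rewrite (dd' y z z')// addrAC.
- move=> y y' z yy' yz; rewrite (dd' y y' z)//.
  have -> : d y y' = d' y y' + m y' - m y by rewrite -md// addrK.
  by rewrite -!addrA; congr (_ + _); rewrite [RHS]addrC !addrA subrK addrC.
Qed.

Lemma intertwined_eq Q (d d' : nebula Q -> nebula Q -> G) :
  fib_cocycle (ev Q) d' -> (forall y y', ev Q y = ev Q y' -> d y y' = d' y y') ->
  intertwined d d'.
Proof.
move=> dP' dd'; apply/(intertwinedP _ dP'); exists (fun=> 0).
by split=> [U p pp|y y' /dd' ->//]; exact: plot_cst.
Qed.

End Intertwiners.

Section Cocycles.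
Context {R : realType} {X : diffType R} {G : abDiffGroupType R}.
Implicit Types Q S T : genFamily X.

Fact pair_nerve_subproof Q (y y' : nebula Q) (e : ev Q y = ev Q y') (i j : 'I_2) :
  ev Q (if i == 0 then y else y') = ev Q (if j == 0 then y else y').
Proof. by case: ifP; case: ifP. Qed.

Definition pair_nerve Q (y y' : nebula Q) (e : ev Q y = ev Q y') : nerve Q 1 :=
  exist _ (fun i : 'I_2 => if i == 0 then y else y') (pair_nerve_subproof e).

Definition point_nerve Q (y : nebula Q) : nerve Q 0 :=
  @exist ('I_1 -> nebula Q) (fun x => forall i j, ev Q (x i) = ev Q (x j))
    (fun=> y) (fun _ _ => erefl).

Lemma nerve_eq Q k (y z : nerve Q k) : sval y =1 sval z -> y = z.
Proof. by case: y z => y py [z pz] /= /funext yz; exact: eq_exist. Qed.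

Lemma pair_nerve_face Q (y : nerve Q 1) :
  y = pair_nerve (svalP y ord0 ord_max).
Proof.
apply: nerve_eq => i /=; case: ifP => /eqP i0; congr (sval y _); apply: val_inj.
  by rewrite i0.
by case: i i0 => -[|[|//]] // ? []; exact: val_inj.
Qed.

(** A 1-cocycle as a function of two points; the value 0 off the fiber product is
    arbitrary. *)
Definition binary Q (c : cocycle G Q 1) (y y' : nebula Q) : G :=
  if pselect (ev Q y = ev Q y') is left e then sval c (pair_nerve e) else 0.

Lemma binaryE Q (c : cocycle G Q 1) y y' (e : ev Q y = ev Q y') :
  binary c y y' = sval c (pair_nerve e).
Proof. by rewrite /binary; case: pselect => // e'; congr (sval c _); exact: nerve_eq. Qed.

Lemma smooth_pair_nerve Q (U : domain R) (g l : U -> nebula Q)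
    (e : forall u, ev Q (g u) = ev Q (l u)) :
  plot g -> plot l -> plot (fun u => pair_nerve (e u)).
Proof. by move=> pg pl i /=; case: (i == 0). Qed.

Lemma cobound1E Q (f : nerve Q 1 -> G) (d : nebula Q -> nebula Q -> G) :
  (forall y y' (e : ev Q y = ev Q y'), f (pair_nerve e) = d y y') ->
  forall y : nerve Q 2, cobound f y =
    d (sval y (lift ord0 ord0)) (sval y ord_max) - d (sval y ord0) (sval y ord_max) +
    d (sval y ord0) (sval y (lift ord0 ord0)).
Proof.
move=> fd y; have fE z : f z = d (sval z ord0) (sval z ord_max).
  by rewrite {1}(pair_nerve_face z) fd.
rewrite /cobound !big_ord_recl big_ord0 !fE /= addr0.
rewrite expr0 expr1 expr2 mulrNN mulr1 mulr1z mulrN1z mulr1z addrA.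
by congr (d _ _ - d _ _ + d _ _); congr (sval y _); exact: val_inj.
Qed.

Lemma cobound0E Q (f : nerve Q 0 -> G) (y : nerve Q 1) :
  cobound f y = f (point_nerve (sval y ord_max)) - f (point_nerve (sval y ord0)).
Proof.
rewrite /cobound !big_ord_recl big_ord0 /= addr0 expr0 expr1 mulr1z mulrN1z.
by congr (f _ - f _); apply: nerve_eq => i /=; congr (sval y _); apply: val_inj;
  rewrite (ord1 i).
Qed.

Lemma binary_cocycle Q (c : cocycle G Q 1) : fib_cocycle (ev Q) (binary c).
Proof.
have [sc dc] := svalP c; split=> [U g l pg pl _ e|y z z' _ yz yz'].
  rewrite (_ : (fun _ => _) = sval c \o (fun u => pair_nerve (e u))).
    by apply: sc; exact: smooth_pair_nerve.
  by apply/funext => u; exact: binaryE.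
pose t (i : 'I_3) : nebula Q := if i == 0 then y else if i == 1 then z else z'.
have tP i j : ev Q (t i) = ev Q (t j).
  by rewrite /t; case: (i == 0); case: (i == 1); case: (j == 0); case: (j == 1);
    rewrite -?yz -?yz'.
have := dc (exist _ t tP).
rewrite (@cobound1E _ _ (binary c)) => [|? ? ?]; last by rewrite -binaryE.
rewrite /t /= => /eqP; rewrite addrAC subr_eq0 addrC => /eqP ->//.
Qed.

Fact cocycle_of_subproof Q (d : nebula Q -> nebula Q -> G) (dP : fib_cocycle (ev Q) d) :
  smooth (fun y : nerve Q 1 => d (sval y ord0) (sval y ord_max)) /\
  forall y, cobound (fun y : nerve Q 1 => d (sval y ord0) (sval y ord_max)) y = 0.
Proof.
have [sd dd] := dP; split=> [U p pp|y].
  exact: (sd U (fun u => sval (p u) ord0) (fun u => sval (p u) ord_max)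
    (pp ord0) (pp ord_max) (fun=> I) (fun u => svalP (p u) _ _)).
rewrite (@cobound1E _ _ d)//.
rewrite (dd (sval y ord0) (sval y (lift ord0 ord0)) (sval y ord_max)) //.
- by rewrite opprD addrCA subrr addr0 addNr.
- exact: (svalP y).
- exact: (svalP y).
Qed.

Definition cocycle_of Q (d : nebula Q -> nebula Q -> G) (dP : fib_cocycle (ev Q) d) :
  cocycle G Q 1 := exist _ _ (cocycle_of_subproof dP).

Lemma binary_cocycle_of Q (d : nebula Q -> nebula Q -> G) (dP : fib_cocycle (ev Q) d) y y' :
  ev Q y = ev Q y' -> binary (cocycle_of dP) y y' = d y y'.
Proof. by move=> e; rewrite (binaryE _ e). Qed.

Lemma cohomologousP Q (c c' : cocycle G Q 1) :
  cohomologous c c' <-> intertwined (binary c) (binary c').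
Proof.
rewrite (intertwinedP _ (binary_cocycle c')); split=> [[h [sh hc]]|[m [sm mc]]].
  exists (h \o @point_nerve Q); split=> [U p pp|y y' e].
    by apply: (sh _ (fun u => point_nerve (p u))) => i.
  have := hc (pair_nerve e); rewrite cobound0E -!binaryE /= => /eqP.
  rewrite subr_eq => /eqP ->; rewrite addrAC subrK addrC//.
exists (fun y => m (sval y ord0)); split=> [U p pp|y]; first exact: (sm _ _ (pp ord0)).
rewrite cobound0E [y]pair_nerve_face -!binaryE /=.
have /eqP := mc _ _ (svalP y ord0 ord_max).
by rewrite -subr_eq => /eqP <-; rewrite opprB addrCA opprD [_ + (_ - _)]addrA subrr add0r.
Qed.

(** The bundle does not change under refinement: the cocycle itself, refined in
    its second variable only, is the isomorphism. *)
Lemma intertwined_pull Q S (r : refinement Q S) (c : cocycle G Q 1) :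
  intertwined (binary c) (binary (pull_cocycle r c)).
Proof.
have [sc dc] := binary_cocycle c.
have pullE z z' : ev S z = ev S z' ->
    binary (pull_cocycle r c) z z' = binary c (ref_nebula r z) (ref_nebula r z').
  move=> e; rewrite (binaryE _ e); have e' : ev Q (ref_nebula r z) = ev Q (ref_nebula r z').
    by rewrite !ev_ref_nebula.
  by rewrite (binaryE _ e') /=; congr (sval c _); apply: nerve_eq => i /=; case: (i == 0).
exists (fun y z => binary c y (ref_nebula r z)); split; [split|].
- move=> U g l pg pl _ fib; apply: (sc U g (fun u => ref_nebula r (l u))) => // [|u].
    exact: smooth_ref_nebula pl.
  by rewrite ev_ref_nebula.
- move=> y z z' _ yz yz'; rewrite pullE -?yz//.
  by apply: dc; rewrite // ev_ref_nebula.
- by move=> y y' z yy' yz; apply: dc; rewrite // ev_ref_nebula.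
Qed.

Definition cech_class Q (c : cocycle G Q 1) : cechH X G 1 :=
  class_of (@refines R X G 1) (existT _ Q (class_of (@cohomologous R X G Q 1) c)).

Lemma cohomology_class_eq Q (c c' : cocycle G Q 1) :
  class_of (@cohomologous R X G Q 1) c = class_of (@cohomologous R X G Q 1) c' ->
  intertwined (binary c) (binary c').
Proof.
apply: (@class_of_sub _ _ (fun c c' : cocycle G Q 1 => intertwined (binary c) (binary c'))).
- by move=> x; apply: intertwined_refl; exact: binary_cocycle.
- by move=> x y; exact: intertwined_sym.
- by move=> x y z; exact: intertwined_trans.
- by move=> x y /cohomologousP.
Qed.

Lemma cech_class_surj (x : cechH X G 1) : exists Q (c : cocycle G Q 1), x = cech_class c.
Proof.
exists (projT1 (repr x)), (repr (projT2 (repr x))).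
rewrite /cech_class class_of_repr -[LHS]class_of_repr.
by congr (class_of _ _); case: (repr x).
Qed.

(** From left to right, the relation on the right is an equivalence that contains
    the transition maps. Conversely, over a common refinement intertwined cocycles
    are cohomologous, so their classes are identified there. *)
Theorem cech_class_eqP Q S (c : cocycle G Q 1) (c' : cocycle G S 1) :
  cech_class c = cech_class c' <-> intertwined (binary c) (binary c').
Proof.
split=> [|cc'].
  pose r' (a b : {Q : genFamily X & famH G Q 1}) :=
    intertwined (binary (repr (projT2 a))) (binary (repr (projT2 b))).
  have reprP Q' (e : cocycle G Q' 1) : intertwined (binary e)
      (binary (repr (class_of (@cohomologous R X G Q' 1) e))).
    by apply: cohomology_class_eq; rewrite class_of_repr.
  move=> /(@class_of_sub _ _ r') H.
  apply: intertwined_trans (reprP _ c) _; apply: intertwined_trans (H _ _ _ _) _.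
  - by move=> x; apply: intertwined_refl; exact: binary_cocycle.
  - by move=> x y; exact: intertwined_sym.
  - by move=> x y z; exact: intertwined_trans.
  - move=> [Q1 a] [Q2 b] [/= r rab]; rewrite /r' /=.
    apply: intertwined_trans (intertwined_pull r (repr a)) _.
    by apply: cohomology_class_eq; rewrite -pullH_class !class_of_repr.
  - exact/intertwined_sym/reprP.
have [T [[r] [r']]] := common_refinement Q S.
have pullE Q' (r0 : refinement Q' T) (e : cocycle G Q' 1) :
    cech_class e = cech_class (pull_cocycle r0 e).
  by apply/class_ofP/rst_step; exists r0; exact: pullH_class.
rewrite (pullE _ r) (pullE _ r'); congr (class_of _ (existT _ T _)).
apply/class_ofP/rst_step/cohomologousP.
apply: intertwined_trans (intertwined_sym (intertwined_pull r c)) _.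
exact: intertwined_trans cc' (intertwined_pull r' c').
Qed.

End Cocycles.

(** * Actions of the relation groupoid *)
Section Actions.
Context {R : realType} {X : diffType R} {G : abDiffGroupType R} {Q : genFamily X}.
Implicit Types A B : commuting_action G Q.

Definition arrow (y y' : nebula Q) (e : ev Q y = ev Q y') : Defs.fprod (ev Q) :=
  exist _ (y, y') e.

Definition action_cocycle A (y y' : nebula Q) : G :=
  if pselect (ev Q y = ev Q y') is left e
  then (sval A (exist _ (arrow e, (y', 0)) erefl)).2 else 0.

(** An action that commutes with G is known from its values on the (y', 0), and the
    anchor forces the first component. *)
Lemma actionE A (h : Defs.fprod (ev Q)) (w : trivial_bundle G Q) e :
  sval A (exist _ (h, w) e) =
  (rel_tgt h, action_cocycle A (rel_tgt h) (rel_src h) + w.2).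
Proof.
case: h w e => [[y y'] e] [w g] e'; have ew : y' = w by exact: e'.
subst w; rewrite /rel_tgt /rel_src /=.
have E : (y', g) = rmulG (y', 0) g :> trivial_bundle G Q by rewrite /rmulG /= add0r.
move: e'; rewrite [X in (_, X)]E => e'.
have e0 : rel_src (arrow e) = Defs.proj ((y', 0) : trivial_bundle G Q) by [].
rewrite (svalP A (arrow e) (y', 0) g e0 e') /rmulG; congr (_, _).
  exact: (act_anchor (sval A)).
rewrite /action_cocycle; case: pselect => // e1; congr (_.2 + _).
by congr (sval A _); apply: eq_exist; congr (_, _); exact: eq_exist.
Qed.

(** The cocycle identity is [act_mul] for composable arrows acting on (z', 0). *)
Lemma action_cocycleP A : fib_cocycle (ev Q) (action_cocycle A).
Proof.
split=> [U g l pg pl _ e|y z z' _ yz yz'].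
  pose hz u : {hz : garr (relGroupoid (ev Q)) * trivial_bundle G Q |
      gsrc hz.1 = Defs.proj hz.2} :=
    exist _ (arrow (e u) : garr (relGroupoid (ev Q)),
             (l u, 0) : trivial_bundle G Q) erefl.
  have phz : plot hz by split; split=> //; exact: plot_cst.
  have [_] := @smooth_act _ _ _ _ (sval A) U hz phz.
  congr plot; apply/funext => u /=.
  by rewrite actionE /= addr0.
have zz' : ev Q z = ev Q z' by rewrite -yz.
pose w : {hz : garr (relGroupoid (ev Q)) * trivial_bundle G Q |
    gsrc hz.1 = Defs.proj hz.2} :=
  exist _ (arrow zz' : garr (relGroupoid (ev Q)), (z', 0) : trivial_bundle G Q) erefl.
have anchor := esym (act_anchor (sval A) w).
have := @act_mul _ _ _ _ (sval A) (arrow yz) (arrow zz') (z', 0) erefl erefl.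
move=> /(_ anchor erefl).
by rewrite !actionE /= !addr0 => -[].
Qed.

Section ActionOf.
Variables (d : nebula Q -> nebula Q -> G) (dP : fib_cocycle (ev Q) d).

Definition cocycle_act
    (hz : {hz : Defs.fprod (ev Q) * trivial_bundle G Q | rel_src hz.1 = hz.2.1}) :
    trivial_bundle G Q :=
  (rel_tgt (sval hz).1, d (rel_tgt (sval hz).1) (rel_src (sval hz).1) + (sval hz).2.2).

Definition action_of : action (@Defs.proj R X G Q).
Proof.
refine (@Action R (relGroupoid (ev Q)) _ (@Defs.proj R X G Q) cocycle_act _ _ _ _ _).
- by move=> U p [].
- move=> U p [[p1 p2] [p3 p4]]; split=> //.
  by apply: plotD p4; apply: dP.1 p1 p2 _ _ => // u; exact: (svalP (sval (p u)).1).
- by [].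
- move=> [[y1 y2] ey] [[z1 z2] ez] [w g] e1 e2 e3 e4.
  have e : y2 = z1 by exact: e1.
  subst z1; rewrite /cocycle_act /rel_tgt /rel_src /=; congr (_, _).
  by rewrite (dP.2 y1 y2 z2) ?addrA// ey.
- move=> [y g] e; congr (_, _); rewrite /rel_tgt /rel_src /=.
  have /eqP := dP.2 y y y I erefl erefl.
  by rewrite -subr_eq subrr eq_sym => /eqP ->; rewrite add0r.
Defined.

Fact action_of_rmulG h z k e e' :
  action_of (exist _ (h, rmulG z k) e') = rmulG (action_of (exist _ (h, z) e)) k.
Proof. by rewrite /action_of /= /cocycle_act /rmulG /= addrA. Qed.

Definition commuting_action_of : commuting_action G Q := exist _ action_of action_of_rmulG.

Lemma action_cocycle_of y y' : ev Q y = ev Q y' ->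
  action_cocycle commuting_action_of y y' = d y y'.
Proof. by move=> e; rewrite /action_cocycle; case: pselect => // e'; exact: addr0. Qed.

End ActionOf.

(** An equivariant map is (y, g) |-> (y, m y + g), where (y, m y) is the image of
    (y, 0), and m is the cochain that relates the two cocycles. *)
Lemma equivariantP A B :
  equivariant A B <-> intertwined (action_cocycle A) (action_cocycle B).
Proof.
rewrite (intertwinedP _ (action_cocycleP B)); split.
  move=> [phi [sphi phiG phi1 phiE]].
  exists (fun y => (phi (y, 0)).2); split=> [U p pp|y y' e].
    have p0 : plot (fun u => (p u, 0) : trivial_bundle G Q).
      by split=> //; exact: plot_cst.
    by have [] := sphi U _ p0.
  have e0 : rel_src (arrow e) = Defs.proj ((y', 0) : trivial_bundle G Q) by [].
  have e1 : rel_src (arrow e) = Defs.proj (phi (y', 0)) by rewrite phi1.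
  have := phiE (arrow e) (y', 0) e0 e1.
  rewrite !actionE /rel_tgt /rel_src /= addr0 => /(congr1 snd) /= <-.
  have -> : (y, action_cocycle A y y') =
      rmulG (y, 0) (action_cocycle A y y') :> trivial_bundle G Q.
    by rewrite /rmulG /= add0r.
  by rewrite phiG /= addrC.
move=> [m [sm md]]; exists (fun z => (z.1, m z.1 + z.2)); split=> //.
- by move=> U p [p1 p2]; split=> //; apply: plotD p2; exact: sm p1.
- by move=> z k; rewrite /rmulG /= addrA.
move=> h [w g] e e'; rewrite !actionE /=; congr (_, _).
have ew : rel_src h = w by exact: e.
rewrite !addrA [m _ + _]addrC -ew md//; exact: (svalP h).
Qed.

End Actions.

(** * The bijection *)
Section Trivialization.
Context {R : realType} {X : diffType R} {G : abDiffGroupType R}.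
Implicit Types Q S : genFamily X.

(** The domains of the plots of Q are the components of the nebula, so the sections
    over them can be chosen independently. *)
Lemma contractible_trivialization Q S (d : nebula S -> nebula S -> G) :
    (forall q : Plot X, members Q q -> contractible (pdom q)) ->
    fib_cocycle (ev S) d ->
  exists h : nebula Q -> nebula S -> G, section_on (ev S) d setT (ev Q) h.
Proof.
move=> hQ dP.
have sec (a : fam_index Q) : exists e, section_on (ev S) d setT (sval a : pdom (sval a) -> X) e.
  apply: (contractible_section (@ev_local_lifts R X S) (pmapP (sval a)) dP).
  by apply: hQ; exact: svalP a.
pose s a := projT1 (cid (sec a)).
have sP a : section_on (ev S) d setT (sval a : pdom (sval a) -> X) (s a) := projT2 (cid (sec a)).
exists (fun y => s (projT1 y) (projT2 y)); split=> [U g l pg pl _ fib|[a u] z z' _].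
  apply: plot_local => u; have [A [oA [Au [a [q [pq gE]]]]]] := pg u.
  exists A, oA; split=> //; set i := @subdom_inc _ _ _ _ in gE *.
  have {}gE v : g (i v) = existT _ a (q v) by exact: gE.
  have si : dom_smooth i by exact: dom_smooth_subdom_inc.
  rewrite (_ : _ \o i = fun v => s a (q v) (l (i v))); last first.
    by apply/funext => v /=; rewrite gE.
  apply: ((sP a).1 _ q (l \o i)) => // [|v]; first exact: plot_comp pl.
  by have := fib (i v); rewrite gE.
exact: (sP a).2.
Qed.

(** The cocycle compares, at two points of the nebula over the same point of X, the
    two values of the section, which lie in the same fiber of the bundle. *)
Lemma trivialization_cocycle Q S (d : nebula S -> nebula S -> G) h :
    section_on (ev S) d setT (ev Q) h ->
  exists2 c : nebula Q -> nebula Q -> G, fib_cocycle (ev Q) c & intertwined c d.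
Proof.
move=> hP; have [sh hd] := hP; have [rep repP] := choice (@ev_surj R X S).
pose c y y' := h y (rep (ev Q y)) - h y' (rep (ev Q y)).
have cE y y' z : ev Q y = ev Q y' -> ev Q y = ev S z -> c y y' = h y z - h y' z.
  move=> e yz; rewrite /c (hd y z (rep (ev Q y)))// (hd y' z (rep (ev Q y))) -?e//.
  by rewrite opprD addrACA subrr addr0.
exists c; last first.
  by exists h; split=> // y y' z e yz; rewrite (cE _ _ z)// subrK.
split=> [U g l pg pl _ e|y z z' _ yz yz'].
  have sg (k : U -> nebula Q) : plot k -> section_on (ev S) d setT (ev Q \o k) (h \o k).
    by move=> pk; apply: section_comp hP => // V q pq; exact: plot_comp pk.
  have sl : section_on (ev S) d setT (ev Q \o g) (h \o l).
    by rewrite (_ : ev Q \o g = ev Q \o l); [exact: sg|apply/funext => u; exact: e].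
  apply: (section_diff_plot (@ev_local_lifts R X S) (sg g pg) sl (g := id)
    (z := fun u => rep (ev Q (g u)))) => //.
    exact: dom_smooth_id.
  exact: (@smooth_ev _ _ Q _ _ pg).
have w := repP (ev Q y).
rewrite (cE y z' _ yz' w) (cE y z _ yz w) (cE z z' (rep (ev Q y))) -?yz//.
by rewrite addrA subrK.
Qed.

End Trivialization.

Theorem corollary5p17 (R : realType) (G : abDiffGroupType R) (X : diffType R)
    (Q : genFamily X)
    (hQ : forall q : Plot X, members Q q -> contractible (pdom q)) :
  exists F : cechH X G 1 -> quotient_by (@equivariant R X G Q), bijective F.
Proof.
pose coc (A : commuting_action G Q) : cocycle G Q 1 := cocycle_of (action_cocycleP A).
have cocP A : intertwined (binary (coc A)) (action_cocycle A).
  by apply: intertwined_eq (action_cocycleP A) _; exact: binary_cocycle_of.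
have classE A B : cech_class (coc A) = cech_class (coc B) <-> equivariant A B.
  rewrite cech_class_eqP equivariantP; split=> AB.
    by apply: intertwined_trans (intertwined_sym (cocP A)) (intertwined_trans AB (cocP B)).
  by apply: intertwined_trans (cocP A) (intertwined_trans AB (intertwined_sym (cocP B))).
have quotE A B : class_of (@equivariant R X G Q) A = class_of (@equivariant R X G Q) B <->
    cech_class (coc A) = cech_class (coc B).
  split=> [|/classE AB]; last by apply/class_ofP/rst_step.
  apply: (@class_of_sub _ _ (fun A B => cech_class (coc A) = cech_class (coc B))) => //.
  - by move=> A' B' C' -> ->.
  - by move=> A' B' /classE.
have coc_surj (x : cechH X G 1) : exists A, cech_class (coc A) = x.
  have [S [d ->]] := cech_class_surj x.
  have [h hP] := contractible_trivialization hQ (binary_cocycle d).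
  have [c cP cd] := trivialization_cocycle hP.
  exists (commuting_action_of cP); apply/cech_class_eqP.
  apply: intertwined_trans (cocP _) (intertwined_trans _ cd).
  by apply: (intertwined_eq cP); exact: action_cocycle_of.
have [F hF] := choice coc_surj.
exists (fun x => class_of (@equivariant R X G Q) (F x)).
exists (fun a => cech_class (coc (repr a))) => [x|a].
  by rewrite -[RHS]hF; apply/quotE; rewrite class_of_repr.
by rewrite -[RHS]class_of_repr; apply/quotE; rewrite hF.
Qed.
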